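(* Let $n,D\ge 1$ be integers and let $U=(u_{tk})$ be a complex random $n\times D$ matrix whose rows $u_{1\cdot},\ldots,u_{n\cdot}$ are independent (not necessarily identically distributed) random (row) vectors in $\mathbb{C}^D$ with $\mathbb{E}|u_{tk}|^2<\infty$ for all $t,k$. Let $Q^{(t)}:=\mathbb{E}(u_{t\cdot}^{*}u_{t\cdot})\in\mathbb{C}^{D\times D}$ with entries $q^{(t)}_{kj}$, and $Q_n:=n^{-1}\sum_{t=1}^{n}Q^{(t)}=\mathbb{E}[n^{-1}U^{*}U]$. Assume there are finite constants $M^{(t)}_{kj1},M^{(t)}_{kj2},v^{(t)}_{kj1},v^{(t)}_{kj2}\ge 0$ such that for all integers $\ell\ge 2$, all $1\le t\le n$ and all $1\le k,j\le D$ $$\mathbb{E}\left[|\operatorname{Re}(\overline{u_{tk}}u_{tj}-q^{(t)}_{kj})|^{\ell}\right]\le 2^{-1}\ell!\,(M^{(t)}_{kj1})^{\ell-2}v^{(t)}_{kj1},\qquad \mathbb{E}\left[|\operatorname{Im}(\overline{u_{tk}}u_{tj}-q^{(t)}_{kj})|^{\ell}\right]\le 2^{-1}\ell!\,(M^{(t)}_{kj2})^{\ell-2}v^{(t)}_{kj2}.$$ For $i=1,2$ set $v_{kjin}:=\sum_{t=1}^{n}v^{(t)}_{kji}$ and $M_{kjin}:=\max\{M^{(t)}_{kji}:1\le t\le n\}$, and let $v_n:=\max\{v_{kj1n},v_{kj2n}:1\le k,j\le D\}$, $M_n:=\max\{M_{kj1n},M_{kj2n}:1\le k,j\le D\}$.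 For $\varepsilon>0$ put $$\Psi:=2\sum_{i=1}^{2}\sum_{k,j=1}^{D}\exp\left(-\frac{n\varepsilon^{2}}{D^{2}\left(4n^{-1}v_{kjin}+2\sqrt{2}\,D^{-1}M_{kjin}\varepsilon\right)}\right).$$ Then for every $\varepsilon>0$, the inequality $\left\Vert n^{-1}U^{*}U-Q_n\right\Vert<\varepsilon$ holds with probability at least $1-\Psi$. Furthermore, $$1-\Psi\ge 1-4D^{2}\exp\left(-\frac{n\varepsilon^{2}}{D^{2}\left(4n^{-1}v_{n}+2\sqrt{2}\,D^{-1}M_{n}\varepsilon\right)}\right).$$ In particular, with probability not less than $1-\Psi$, $$\lambda_{\min}(Q_n)-\varepsilon<\lambda_{\min}(n^{-1}U^{*}U)\le\lambda_{\max}(n^{-1}U^{*}U)<\lambda_{\max}(Q_n)+\varepsilon.$$ Consequently, if $Q_n$ is non-singular and $\varepsilon\in(0,\lambda_{\min}(Q_n))$, the condition number of $U^{*}U$ is bounded by $\frac{\lambda_{\max}(Q_n)+\varepsilon}{\lambda_{\min}(Q_n)-\varepsilon}$ with probability not less than $1-\Psi$.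
   Context: For a matrix $A$, $A^{*}$ is its conjugate transpose, $\Vert A\Vert=\lambda_{\max}(A^{*}A)^{1/2}$ is the operator norm, and for hermitian $A$, $\lambda_{\max}(A)$, $\lambda_{\min}(A)$ are the largest and smallest eigenvalues; the condition number of $A$ is $\lambda_{\max}(A)/\lambda_{\min}(A)$. Conventions: $0^{0}=1$ in the moment bounds; any exponential term whose displayed denominator is zero (i.e. the corresponding $v$ and $M$ both vanish) is interpreted as $0$. *)

(* Defs.v *)
From HB Require Import structures.
From mathcomp Require Import all_boot all_order all_algebra.
From mathcomp Require Import sesquilinear spectral.
From mathcomp Require Import all_classical all_reals all_analysis.
From mathcomp.real_closed Require Import complex.

Set Implicit Arguments.
Unset Strict Implicit.
Unset Printing Implicit Defensive.

Import Order.TTheory GRing.Theory Num.Theory.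
Import numFieldNormedType.Exports.

Local Open Scope classical_set_scope.
Local Open Scope ring_scope.
Local Open Scope complex_scope.
Local Open Scope sesquilinear_scope.

Section spectrum.
Context {R : realType} {m : nat}.
Implicit Type A : 'M[R[i]]_m.

(* For m > 0 and A hermitian, the real eigenvalues are all the eigenvalues and
   form a nonempty finite set, so that the sup is a maximum and the inf a
   minimum.  (eigenvalue refers to row eigenvectors, which does not change the
   set of eigenvalues.) *)
Definition lambda_max A : R := sup [set r : R | eigenvalue A r%:C].
Definition lambda_min A : R := inf [set r : R | eigenvalue A r%:C].

Definition opnorm A : R := Num.sqrt (lambda_max (A ^t* *m A)).

(* Meaningful only for A nonsingular, since x / 0 = 0 here. *)
Definition cond_number A : R := lambda_max A / lambda_min A.

End spectrum.

Section probability.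
Context {d : measure_display} {T : measurableType d} {R : realType}.
Variable P : probability T R.

Definition with_prob_ge (p : R) (E : set T) : Prop :=
  measurable E /\ (p%:E <= P E)%E.

Definition mutually_independent (I : finType) (F : I -> set (set T)) : Prop :=
  forall (J : {set I}) (E : I -> set T), (forall i, i \in J -> F i (E i)) ->
    P (\bigcap_(i in [set` J]) E i) = (\prod_(i in J) P (E i))%E.

Definition cmeasurable (X : T -> R[i]) : Prop :=
  measurable_fun setT (fun w => complex.Re (X w)) /\
  measurable_fun setT (fun w => complex.Im (X w)).

(* fine is harmless for integrable X, the only ones to which this is applied *)
Definition cexpectation (X : T -> R[i]) : R[i] :=
  fine 'E_P[fun w => complex.Re (X w)] +i*
  fine 'E_P[fun w => complex.Im (X w)].

Definition mx_expectation (p q : nat) (X : T -> 'M[R[i]]_(p, q)) :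
    'M[R[i]]_(p, q) :=
  \matrix_(k, j) cexpectation (fun w => X w k j).

Context {n D : nat}.
Variable U : T -> 'M[R[i]]_(n, D).

(* The sigma-algebra generated by row t of U, as a random vector in C^D with
   C identified with R * R. *)
Definition row_sigma (t : 'I_n) : set (set T) :=
  g_sigma_preimage
    (fun (k : 'I_D) w => (complex.Re (U w t k), complex.Im (U w t k))).

Definition independent_rows : Prop := mutually_independent row_sigma.

Definition row_moment (t : 'I_n) : 'M[R[i]]_D :=
  mx_expectation (fun w => (row t (U w)) ^t* *m row t (U w)).

Definition mean_moment : 'M[R[i]]_D := n%:R^-1 *: \sum_t row_moment t.

Definition sample_moment (w : T) : 'M[R[i]]_D :=
  n%:R^-1 *: ((U w) ^t* *m U w).

End probability.

Section bernstein.
Context {R : realType} {n D : nat}.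

Definition bernstein_exp (v M eps : R) : R :=
  let den := D%:R ^+ 2 *
    (4 * n%:R^-1 * v + 2 * Num.sqrt 2 * D%:R^-1 * M * eps) in
  if den == 0 then 0 else expR (- (n%:R * eps ^+ 2 / den)).

(* v i t k j and M i t k j are the constants for entry (k, j) and row t, where
   i = 0 stands for the real parts and i = 1 for the imaginary parts. *)
Variables v M : 'I_2 -> 'I_n -> 'I_D -> 'I_D -> R.

Definition v_sum (i : 'I_2) (k j : 'I_D) : R := \sum_t v i t k j.

(* All families below are nonnegative where these maxima are used, so the
   default value 0 does not affect them. *)
Definition M_max (i : 'I_2) (k j : 'I_D) : R :=
  \big[Num.max/0]_(t < n) M i t k j.

Definition v_bound : R :=
  \big[Num.max/0]_(i < 2) \big[Num.max/0]_(k < D) \big[Num.max/0]_(j < D)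
    v_sum i k j.

Definition M_bound : R :=
  \big[Num.max/0]_(i < 2) \big[Num.max/0]_(k < D) \big[Num.max/0]_(j < D)
    M_max i k j.

Definition Psi (eps : R) : R :=
  2 * \sum_(i < 2) \sum_(k < D) \sum_(j < D)
    bernstein_exp (v_sum i k j) (M_max i k j) eps.

End bernstein.

Arguments bernstein_exp {R} n D v M eps.

(* Main.v *)
(* The operator norm of S := n^-1 U^* U - Q_n is at most its Frobenius norm, so
   it is below eps as soon as the real and imaginary parts of all D^2 entries are
   below eps / (sqrt 2 D) in absolute value.  Each such part is a mean of n
   independent centered variables satisfying Bernstein's moment condition, and
   Psi is the sum of the 2 D^2 two-sided Bernstein bounds.  Weyl's inequality
   turns the bound on S into the bounds on the extreme eigenvalues, and hence on
   the condition number. *)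

Require Import Defs.
From HB Require Import structures.
From mathcomp Require Import all_boot all_order all_algebra.
From mathcomp Require Import sesquilinear spectral.
From mathcomp Require Import all_classical all_reals all_analysis.
From mathcomp.real_closed Require Import complex.
From mathcomp Require Import measurable_realfun ring lra.

Set Implicit Arguments.
Unset Strict Implicit.
Unset Printing Implicit Defensive.

Import Order.TTheory GRing.Theory Num.Theory.
Import numFieldNormedType.Exports.
Import HBNNSimple.

Local Open Scope classical_set_scope.
Local Open Scope ring_scope.
Local Open Scope complex_scope.
Local Open Scope sesquilinear_scope.

(** * Spectra of hermitian matrices *)

Section hermitian_spectrum.
Context {R : realType}.
Local Notation C := R[i].

(** [with_prob_ge] asks for measurable events, whereas the extreme eigenvalues are given as a [sup]
    and an [inf]. Their measurability is obtained by algebra: the characteristic polynomial of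
    [A - c%:C%:M] is real-rooted, so [lambda_max A < c] means that all its coefficients are
    positive, and these are polynomials in the entries of [A]. Independence is a statement about the
    sigma-algebras of the rows, while Chernoff's method needs the integral of a product of
    exponentials; the passage exchanges indicators for functions one factor at a time. It is used
    across the rows for a fixed entry; different entries are combined by a union bound. The
    threshold eps / (sqrt 2 D) comes from the count of the parts: 2 D^2 squares, each below eps^2 /
    (2 D^2), add up to less than eps^2. A total variance of 0 is a case of its own, where Chernoff's
    parameter breaks down and the summands vanish almost surely. *)

Lemma hermitian_spectral m (A : 'M[C]_m) : A ^t* = A ->
  exists (Q : 'M[C]_m) (d : 'I_m -> R),
    Q \is unitarymx /\ A = Q ^t* *m diag_mx (\row_i (d i)%:C) *m Q.
Proof.
move=> Ah; have hA : A \is hermsymmx.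
  by apply/is_hermitianmxP; rewrite expr0 scale1r Ah.
have dE : \row_i (complex.Re (spectral_diag A 0 i))%:C = spectral_diag A.
  apply/rowP => i; rewrite mxE.
  have /mxOverP/(_ 0 i) := hermitian_spectral_diag_real hA.
  by move=> /complex_realP[r ->].
have /orthomx_spectralP AE := hermitian_normalmx hA.
exists (spectralmx A), (fun i => complex.Re (spectral_diag A 0 i)).
split; first exact: spectral_unitarymx.
rewrite dE -invmx_unitary; last exact: spectral_unitarymx.
exact: AE.
Qed.

Lemma char_poly_unitary_conj m (Q : 'M[C]_m) (d : 'I_m -> C) : Q \is unitarymx ->
  char_poly (Q ^t* *m diag_mx (\row_i d i) *m Q) = \prod_i ('X - (d i)%:P).
Proof.
move=> Qu; have QQ : Q ^t* *m Q = 1%:M.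
  by rewrite -invmx_unitary// mulVmx// unitarymx_unit.
have -> : char_poly (Q ^t* *m diag_mx (\row_i d i) *m Q) =
    char_poly (diag_mx (\row_i d i)).
  rewrite /char_poly; set D := diag_mx _.
  have -> : char_poly_mx (Q ^t* *m D *m Q) =
      map_mx polyC (Q ^t*) *m char_poly_mx D *m map_mx polyC Q.
    rewrite /char_poly_mx mulmxBr mulmxBl !map_mxM; congr (_ - _).
    by rewrite -mulmxA -scalar_mxC mulmxA -map_mxM QQ map_mx1 mul1mx.
  rewrite !det_mulmx mulrAC -det_mulmx -map_mxM QQ map_mx1 det1 mul1r.
  by [].
rewrite char_poly_trig ?diag_mx_is_trig//.
by apply: eq_bigr => i _; rewrite !mxE eqxx mulr1n.
Qed.

(** Left in [R[i]], where an inequality also asserts that the difference is real, so that Rayleigh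
    bounds can be written without real parts. *)
Definition sqnorm m (x : 'rV[C]_m) : C := (x *m x ^t*) 0 0.

Lemma sqnormE m (x : 'rV[C]_m) : sqnorm x = \sum_i `|x 0 i| ^+ 2.
Proof. by rewrite /sqnorm mxE; apply: eq_bigr => i _; rewrite !mxE normCK. Qed.

Lemma sqnorm_ge0 m (x : 'rV[C]_m) : 0 <= sqnorm x.
Proof. by rewrite sqnormE sumr_ge0// => i _; rewrite exprn_ge0. Qed.

Lemma sqnorm_gt0 m (x : 'rV[C]_m) : x != 0 -> 0 < sqnorm x.
Proof.
move=> x0; rewrite lt_def sqnorm_ge0 andbT; apply: contra x0.
rewrite sqnormE psumr_eq0; last by move=> i _; rewrite exprn_ge0.
move=> /allP xi0; apply/eqP/rowP => i; rewrite mxE; apply/eqP.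
by have := xi0 i (mem_index_enum _); rewrite sqrf_eq0 normr_eq0.
Qed.

Section decomposition.
Context {m : nat} (A Q : 'M[C]_m) (d : 'I_m -> R).
Hypotheses (Qu : Q \is unitarymx)
  (AE : A = Q ^t* *m diag_mx (\row_i (d i)%:C) *m Q).

Lemma char_poly_spectral : char_poly A = \prod_i ('X - ((d i)%:C)%:P).
Proof. by rewrite AE char_poly_unitary_conj. Qed.

Lemma eigenvalue_spectral (r : R) :
  eigenvalue A r%:C <-> exists i, d i = r.
Proof.
rewrite eigenvalue_root_char char_poly_spectral /root horner_prod; split.
  move=> /prodf_eq0[i _]; rewrite !hornerE subr_eq0 => /eqP/complexI ->.
  by exists i.
by move=> [i <-]; apply/prodf_eq0; exists i => //; rewrite !hornerE subrr.
Qed.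

(** In the coordinates [y] the form is the sum of [d i] times the squared modulus of [y 0 i], and
    the unitary change of coordinates preserves [sqnorm]. *)
Lemma rayleigh_spectral (l : R) (x : 'rV[C]_m) : (forall i, d i <= l) ->
  (x *m A *m x ^t*) 0 0 <= l%:C * sqnorm x.
Proof.
move=> dl; pose y := x *m Q ^t*.
have yE : y ^t* = Q *m x ^t*.
  by rewrite /y trmx_mul map_mxM trmxCK.
have -> : sqnorm x = sqnorm y.
  rewrite /sqnorm yE /y mulmxA -(mulmxA x) -invmx_unitary// mulVmx ?mulmx1//.
  exact: unitarymx_unit.
have -> : x *m A *m x ^t* = y *m diag_mx (\row_i (d i)%:C) *m y ^t*.
  by rewrite yE AE !mulmxA.
rewrite sqnormE mxE mulr_sumr ler_sum// => i _.
rewrite mul_mx_diag !mxE mulrAC -normCK mulrC ler_wpM2r ?exprn_ge0//.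
by rewrite lecR.
Qed.

Lemma mxtrace_spectral : \tr A = (\sum_i d i)%:C.
Proof.
rewrite AE -mulmxA mxtrace_mulC -mulmxA -invmx_unitary// mulmxV ?unitarymx_unit//.
rewrite mulmx1 mxtrace_diag rmorph_sum/=.
by apply: eq_bigr => i _; rewrite mxE.
Qed.

End decomposition.

Lemma lambda_max_eq m (A : 'M[C]_m) (l : R) : eigenvalue A l%:C ->
  (forall r : R, eigenvalue A r%:C -> r <= l) -> lambda_max A = l.
Proof.
move=> Al lub; apply/eqP; rewrite eq_le; apply/andP; split.
  by apply: ge_sup; [exists l|exact: lub].
by apply: ub_le_sup => //; exists l => r; exact: lub.
Qed.

(** Replaces the [sup] by an attained maximum: the real eigenvalues are the finitely many [d i], and
    [0 < m] provides one. *)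
Lemma lambda_max_hermitian m (A : 'M[C]_m) : (0 < m)%N -> A ^t* = A ->
  eigenvalue A (lambda_max A)%:C /\
  forall r : R, eigenvalue A r%:C -> r <= lambda_max A.
Proof.
move=> m0 Ah; have [Q [d [Qu AE]]] := hermitian_spectral Ah.
have [i _ di] := @Order.TotalTheory.arg_maxP _ _ _ (Ordinal m0) xpredT d isT.
have Ai : eigenvalue A (d i)%:C by apply/(eigenvalue_spectral Qu AE); exists i.
have ub (r : R) : eigenvalue A r%:C -> r <= d i.
  by move=> /(eigenvalue_spectral Qu AE)[j <-]; exact: di.
by rewrite (lambda_max_eq Ai ub).
Qed.

Lemma rayleigh m (A : 'M[C]_m) (x : 'rV[C]_m) : (0 < m)%N -> A ^t* = A ->
  (x *m A *m x ^t*) 0 0 <= (lambda_max A)%:C * sqnorm x.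
Proof.
move=> m0 Ah; have [_ ub] := lambda_max_hermitian m0 Ah.
have [Q [d [Qu AE]]] := hermitian_spectral Ah.
apply: (rayleigh_spectral Qu AE) => i; apply: ub.
by apply/(eigenvalue_spectral Qu AE); exists i.
Qed.

Lemma hermitianD m (A B : 'M[C]_m) :
  A ^t* = A -> B ^t* = B -> (A + B) ^t* = A + B.
Proof. by move=> Ah Bh; rewrite linearD/= map_mxD Ah Bh. Qed.

Lemma hermitianN m (A : 'M[C]_m) : A ^t* = A -> (- A) ^t* = - A.
Proof. by move=> Ah; rewrite linearN/= map_mxN Ah. Qed.

Lemma conjC_real (c : R) : Num.conj (c%:C : C) = c%:C.
Proof. exact: conjc_real. Qed.

Lemma hermitian_scalar m (c : R) : (c%:C%:M : 'M[C]_m) ^t* = c%:C%:M.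
Proof. by rewrite tr_scalar_mx map_scalar_mx/= conjC_real. Qed.

Lemma hermitian_gram p m (A : 'M[C]_(p, m)) : (A ^t* *m A) ^t* = A ^t* *m A.
Proof. by rewrite trmx_mul map_mxM trmxCK. Qed.

Lemma hermitianZ m (c : R) (A : 'M[C]_m) :
  A ^t* = A -> (c%:C *: A) ^t* = c%:C *: A.
Proof. by move=> Ah; rewrite linearZ/= map_mxZ Ah/= conjC_real. Qed.

(** This is the form of Weyl's inequality used below. At an eigenvector of [A + B] for its largest
    eigenvalue the two Rayleigh bounds add up, and the positive [sqnorm x] cancels. *)
Lemma lambda_maxD m (A B : 'M[C]_m) : (0 < m)%N -> A ^t* = A -> B ^t* = B ->
  lambda_max (A + B) <= lambda_max A + lambda_max B.
Proof.
move=> m0 Ah Bh.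
have [/eigenvalueP[x xAB x0] _] := lambda_max_hermitian m0 (hermitianD Ah Bh).
have := lerD (rayleigh x m0 Ah) (rayleigh x m0 Bh).
rewrite -mulrDl -rmorphD/=.
have -> : (x *m A *m x ^t*) 0 0 + (x *m B *m x ^t*) 0 0 =
    (lambda_max (A + B))%:C * sqnorm x.
  transitivity ((x *m (A + B) *m x ^t*) 0 0).
    rewrite mulmxDr mulmxDl.
    by move: (x *m A *m x ^t*) (x *m B *m x ^t*) => a b; rewrite mxE.
  by rewrite xAB -scalemxAl mxE.
by rewrite ler_pM2r ?sqnorm_gt0// lecR.
Qed.

Lemma eigenvalueN m (A : 'M[C]_m) (a : C) : eigenvalue (- A) (- a) = eigenvalue A a.
Proof.
apply/eigenvalueP/eigenvalueP => -[x xA x0]; exists x => //.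
  by apply: oppr_inj; rewrite -mulmxN xA scaleNr.
by rewrite mulmxN xA scaleNr.
Qed.

Lemma real_complexN (r : R) : (- r)%:C = - r%:C :> C.
Proof. exact: rmorphN. Qed.

Lemma real_complexM (r s : R) : (r * s)%:C = r%:C * s%:C :> C.
Proof. exact: rmorphM. Qed.

(** [inf] is defined by negating a [sup], and negating [A] negates its eigenvalues. All facts about
    [lambda_min] are transferred through this identity. *)
Lemma lambda_minE m (A : 'M[C]_m) : lambda_min A = - lambda_max (- A).
Proof.
rewrite /lambda_min /lambda_max /inf; congr (- sup _).
apply/seteqP; split=> [_ [s /= As <-]|r /= Ar].
  rewrite real_complexN. by rewrite eigenvalueN.
exists (- r); last by rewrite opprK.
rewrite /= real_complexN.
by rewrite -(eigenvalueN A) opprK.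
Qed.

Lemma lambda_min_le_max m (A : 'M[C]_m) : (0 < m)%N -> A ^t* = A ->
  lambda_min A <= lambda_max A.
Proof.
move=> m0 Ah; rewrite lambda_minE lerNl.
have [Al _] := lambda_max_hermitian m0 Ah.
have [_ ub] := lambda_max_hermitian m0 (hermitianN Ah).
by apply: ub; rewrite real_complexN eigenvalueN.
Qed.

Lemma lambda_maxZ m (c : R) (A : 'M[C]_m) : (0 < m)%N -> A ^t* = A -> 0 < c ->
  lambda_max (c%:C *: A) = c * lambda_max A.
Proof.
move=> m0 Ah c0; have c0' : c%:C != 0.
  by apply: contraTneq c0 => /complexI ->; rewrite ltxx.
have [/eigenvalueP[x xA x0] ub] := lambda_max_hermitian m0 Ah.
apply: lambda_max_eq => [|r /eigenvalueP[y yA y0]].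
  by apply/eigenvalueP; exists x => //; rewrite -scalemxAr xA scalerA -real_complexM.
rewrite mulrC -ler_pdivrMr//; apply: ub; apply/eigenvalueP; exists y => //.
apply: (scalerI c0'); rewrite scalemxAr yA scalerA -real_complexM mulrC divfK//.
by rewrite gt_eqF.
Qed.

Lemma lambda_minZ m (c : R) (A : 'M[C]_m) : (0 < m)%N -> A ^t* = A -> 0 < c ->
  lambda_min (c%:C *: A) = c * lambda_min A.
Proof.
move=> m0 Ah c0; rewrite !lambda_minE -scalerN lambda_maxZ ?mulrN//.
exact: hermitianN.
Qed.

Lemma lambda_max_shift m (A : 'M[C]_m) (c : R) : (0 < m)%N -> A ^t* = A ->
  lambda_max (A - c%:C%:M) = lambda_max A - c.
Proof.
move=> m0 Ah; have [/eigenvalueP[x xA x0] ub] := lambda_max_hermitian m0 Ah.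
apply: lambda_max_eq => [|r /eigenvalueP[y yA y0]].
  apply/eigenvalueP; exists x => //.
  by rewrite mulmxBr xA mul_mx_scalar -scalerBl -rmorphB.
rewrite lerBrDr; apply: ub; apply/eigenvalueP; exists y => //.
by rewrite -[A](subrK c%:C%:M) mulmxDr yA mul_mx_scalar -scalerDl -rmorphD.
Qed.

(** If [l] is an eigenvalue of the hermitian [A], then [l ^+ 2] is one of [A ^t* *m A], and [l] is
    at most the square root of its square. *)
Lemma lambda_max_le_opnorm m (A : 'M[C]_m) : (0 < m)%N -> A ^t* = A ->
  lambda_max A <= opnorm A.
Proof.
move=> m0 Ah; have [/eigenvalueP[x xA x0] _] := lambda_max_hermitian m0 Ah.
have [_ ub] := lambda_max_hermitian m0 (hermitian_gram A).
apply: le_trans (ler_norm _) _; rewrite -sqrtr_sqr ler_wsqrtr// ub//.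
apply/eigenvalueP; exists x => //.
by rewrite Ah mulmxA xA -scalemxAl xA scalerA -real_complexM.
Qed.

Lemma opnormN m (A : 'M[C]_m) : opnorm (- A) = opnorm A.
Proof. by rewrite /opnorm [(- A)^T]linearN/= map_mxN mulNmx mulmxN opprK. Qed.

Lemma sqr_normcE (z : C) :
  `|z| ^+ 2 = (complex.Re z ^+ 2 + complex.Im z ^+ 2)%:C.
Proof.
rewrite normCK; case: z => a b; rewrite -[Num.conj _]/(a -i* b).
by apply/eqP; rewrite eq_complex /=; apply/andP; split; apply/eqP; ring.
Qed.

Lemma eigenvalue_gram_ge0 p m (A : 'M[C]_(p, m)) (r : R) :
  eigenvalue (A ^t* *m A) r%:C -> 0 <= r.
Proof.
move=> /eigenvalueP[x xA x0].
have : 0 <= r%:C * sqnorm x.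
  suff -> : r%:C * sqnorm x = sqnorm (x *m A ^t*) by exact: sqnorm_ge0.
  rewrite /sqnorm trmx_mul map_mxM trmxCK mulmxA -[x *m A ^t* *m A]mulmxA xA.
  by rewrite -scalemxAl; move: (x *m x ^t*) => B; rewrite mxE.
by rewrite pmulr_lge0 ?sqnorm_gt0// lecR.
Qed.

(** The right-hand side is the squared Frobenius norm, that is, the trace of the Gram matrix and
    hence the sum of its eigenvalues. As these are nonnegative, one of them is at most the sum. *)
Lemma lambda_max_gram_le p m (A : 'M[C]_(p, m)) : (0 < m)%N ->
  lambda_max (A ^t* *m A) <=
    \sum_j \sum_k (complex.Re (A k j) ^+ 2 + complex.Im (A k j) ^+ 2).
Proof.
move=> m0; set G := A ^t* *m A.
have Gh : G ^t* = G := hermitian_gram A.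
have [Q [d [Qu GE]]] := hermitian_spectral Gh.
have [/(eigenvalue_spectral Qu GE)[i <-] _] := lambda_max_hermitian m0 Gh.
have -> : \sum_j \sum_k (complex.Re (A k j) ^+ 2 + complex.Im (A k j) ^+ 2)
    = \sum_i d i.
  apply: complexI; rewrite -(mxtrace_spectral Qu GE) rmorph_sum.
  apply: eq_bigr => j _; rewrite mxE rmorph_sum; apply: eq_bigr => k _.
  by rewrite /= -sqr_normcE !mxE normCK mulrC.
rewrite (bigD1 i)//= lerDl sumr_ge0// => j _.
apply: (@eigenvalue_gram_ge0 _ _ A).
by apply/(eigenvalue_spectral Qu GE); exists j.
Qed.

Lemma lambda_min_hermitian m (A : 'M[C]_m) : (0 < m)%N -> A ^t* = A ->
  eigenvalue A (lambda_min A)%:C /\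
  forall r : R, eigenvalue A r%:C -> lambda_min A <= r.
Proof.
move=> m0 Ah; have [Al ub] := lambda_max_hermitian m0 (hermitianN Ah).
rewrite lambda_minE; split => [|r Ar].
  by rewrite -(eigenvalueN A) real_complexN opprK; exact: Al.
by rewrite lerNl; apply: ub; rewrite real_complexN eigenvalueN; exact: Ar.
Qed.

Lemma unitmx_eigenvalue m (A : 'M[C]_m) :
  (A \in unitmx) = ~~ eigenvalue A (0 : R)%:C.
Proof.
have -> : (0 : R)%:C = 0 :> C by [].
rewrite unitmxE unitfE; congr (~~ _); apply/det0P/eigenvalueP => -[x].
  by move=> x0 xA; exists x => //; rewrite scale0r.
by rewrite scale0r => xA x0; exists x.
Qed.

(** The eigenvalues of a Gram matrix are nonnegative, so 0 fails to be one exactly when the smallest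
    is positive. *)
Lemma gram_unitmx p m (A : 'M[C]_(p, m)) : (0 < m)%N ->
  (A ^t* *m A \in unitmx) = (0 < lambda_min (A ^t* *m A)).
Proof.
move=> m0; have [Al lb] := lambda_min_hermitian m0 (hermitian_gram A).
have l0 := eigenvalue_gram_ge0 Al.
rewrite unitmx_eigenvalue; move: Al lb l0.
move: (A ^t* *m A) (lambda_min _) => G l Gl lb l0.
rewrite lt_def l0 andbT; congr (~~ _); apply/idP/eqP => [G0|<-//].
by apply/eqP; rewrite eq_le l0 lb.
Qed.

(** Induction on the factors, each of the form X + a with a > 0. Nonnegativity is carried for every
    [k] because the new leading coefficient involves an old one beyond the degree, which is not
    positive. *)
Lemma prod_XsubC_coef_ge0 (I : Type) (s : seq I) (r : I -> R) (k : nat) :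
  (forall i, r i < 0) ->
  let c := (\prod_(i <- s) ('X - (r i)%:P))`_k in
  0 <= c /\ ((k <= size s)%N -> 0 < c).
Proof.
move=> r0; elim: s k => [|i s IH] k /=.
  by rewrite big_nil coef1; split; [exact: ler0n|rewrite leqn0 => ->].
have ri : 0 < - r i by rewrite oppr_gt0.
rewrite big_cons mulrBl coefB coefXM coefCM -mulNr.
have [IH1 IH2] := IH k; case: k IH1 IH2 => [|k] IH1 IH2 /=.
  by rewrite add0r; split=> [|_]; [rewrite mulr_ge0// ltW|rewrite mulr_gt0// IH2].
have [IH3 IH4] := IH k; split=> [|ks].
  by rewrite addr_ge0// mulr_ge0// ltW.
by rewrite ltr_pwDl ?IH4// mulr_ge0// ltW.
Qed.

(** For the converse, a polynomial with positive coefficients is positive at every nonnegative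
    point, so none of its roots lies there. *)
Lemma prod_XsubC_coef_gt0 m (r : 'I_m -> R) :
  (forall i, r i < 0) <->
  (forall k, (k <= m)%N -> 0 < (\prod_i ('X - (r i)%:P))`_k).
Proof.
have sm : size (index_enum 'I_m) = m by rewrite [index_enum _]unlock -enumT -cardE card_ord.
split=> [r0 k km|c0 i].
  by apply: (prod_XsubC_coef_ge0 _ _ r0).2; rewrite sm.
rewrite ltNge; apply/negP => ri.
set p := \prod_i ('X - (r i)%:P) in c0.
have : p.[r i] = 0.
  rewrite horner_prod; apply/eqP/prodf_eq0; exists i => //.
  by rewrite !hornerE subrr.
have sp : size p = m.+1 by rewrite size_prod_XsubC sm.
rewrite horner_coef sp big_ord_recl expr0 mulr1 => /eqP.
rewrite gt_eqF// ltr_pwDl ?c0//; apply: sumr_ge0 => j _.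
by rewrite mulr_ge0 ?exprn_ge0// ltW// c0// -ltnS ltn_ord.
Qed.

(* A real-rooted polynomial has only negative roots iff its coefficients are all
   positive, which makes [lambda_max A < c] a condition on polynomials in the
   entries of A. *)
Lemma lambda_max_lt m (A : 'M[C]_m) (c : R) : (0 < m)%N -> A ^t* = A ->
  lambda_max A < c <->
  forall k, (k <= m)%N -> 0 < complex.Re (char_poly (A - c%:C%:M))`_k.
Proof.
move=> m0 Ah; rewrite -subr_lt0 -lambda_max_shift//.
have : (A - c%:C%:M) ^t* = A - c%:C%:M.
  by apply: hermitianD => //; apply: hermitianN; exact: hermitian_scalar.
move: (A - _) => {Ah}A Ah.
have [Q [d [Qu AE]]] := hermitian_spectral Ah.
have -> : char_poly A = map_poly (real_complex R) (\prod_i ('X - (d i)%:P)).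
  rewrite (char_poly_spectral Qu AE) rmorph_prod; apply: eq_bigr => i _.
  by rewrite rmorphB/= map_polyX map_polyC.
have [Al ub] := lambda_max_hermitian m0 Ah.
have -> : lambda_max A < 0 <-> forall i, d i < 0.
  split=> [l0 i|d0].
    by apply: le_lt_trans l0; apply: ub; apply/(eigenvalue_spectral Qu AE); exists i.
  by move: Al => /(eigenvalue_spectral Qu AE)[i <-].
rewrite prod_XsubC_coef_gt0.
by split=> H k /H; rewrite coef_map.
Qed.

(** Subadditivity of [lambda_max] is applied to [B + (A - B)] for the upper bound and to the
    opposite matrices for the lower one; [opnorm] controls [A - B] with either sign. *)
Lemma lambda_perturbation m (A B : 'M[C]_m) (eps : R) : (0 < m)%N ->
  A ^t* = A -> B ^t* = B -> opnorm (A - B) < eps ->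
  lambda_min B - eps < lambda_min A /\ lambda_max A < lambda_max B + eps.
Proof.
move=> m0 Ah Bh ABe; have Sh := hermitianD Ah (hermitianN Bh); split.
  rewrite !lambda_minE -opprD ltrN2.
  have -> : - A = - B + - (A - B) by rewrite opprB addrA addNr add0r.
  apply: le_lt_trans (lambda_maxD m0 (hermitianN Bh) (hermitianN Sh)) _.
  rewrite ltrD2l; apply: le_lt_trans (lambda_max_le_opnorm m0 (hermitianN Sh)) _.
  by rewrite opnormN.
have -> : A = B + (A - B) by rewrite addrC subrK.
apply: le_lt_trans (lambda_maxD m0 Bh Sh) _.
by rewrite ltrD2l; exact: le_lt_trans (lambda_max_le_opnorm m0 Sh) ABe.
Qed.

(** Clears the division. With [s = n%:R^-1] the right-hand side concerns the eigenvalues of the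
    sample moment. Nonsingularity belongs to the event because dividing by a zero [lambda_min] would
    give 0. *)
Lemma gram_cond_number_le p m (A : 'M[C]_(p, m)) (s c : R) : (0 < m)%N -> 0 < s ->
  (A ^t* *m A \in unitmx /\ cond_number (A ^t* *m A) <= c) <->
  (0 < s * lambda_min (A ^t* *m A) /\
   s * lambda_max (A ^t* *m A) <= c * (s * lambda_min (A ^t* *m A))).
Proof.
move=> m0 s0; rewrite gram_unitmx// /cond_number.
move: (lambda_min _) (lambda_max _) => a b; rewrite pmulr_rgt0//.
by split=> -[a0]; rewrite ler_pdivrMr// [c * (s * a)]mulrCA ler_pM2l.
Qed.

End hermitian_spectrum.

(** * Measurability of extreme eigenvalues *)

Section measurability.
Context {d : measure_display} {T : measurableType d} {R : realType}.
Local Notation C := R[i].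

Lemma ReM (x y : C) : complex.Re (x * y) =
  complex.Re x * complex.Re y - complex.Im x * complex.Im y.
Proof. by case: x y => a b [a' b']. Qed.

Lemma ImM (x y : C) : complex.Im (x * y) =
  complex.Re x * complex.Im y + complex.Im x * complex.Re y.
Proof. by case: x y => a b [a' b']. Qed.

Lemma ReD (x y : C) : complex.Re (x + y) = complex.Re x + complex.Re y.
Proof. by case: x y => a b [a' b']. Qed.

Lemma ImD (x y : C) : complex.Im (x + y) = complex.Im x + complex.Im y.
Proof. by case: x y => a b [a' b']. Qed.

Lemma Re_sum (I : Type) (s : seq I) (F : I -> C) :
  complex.Re (\sum_(i <- s) F i) = \sum_(i <- s) complex.Re (F i).
Proof. exact: (big_morph _ ReD (erefl : complex.Re (0 : C) = 0)). Qed.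

Lemma Im_sum (I : Type) (s : seq I) (F : I -> C) :
  complex.Im (\sum_(i <- s) F i) = \sum_(i <- s) complex.Im (F i).
Proof. exact: (big_morph _ ImD (erefl : complex.Im (0 : C) = 0)). Qed.

Lemma cmeasurable_cst (c : C) : cmeasurable (fun _ : T => c).
Proof. by split; exact: measurable_cst. Qed.

Lemma cmeasurableD (X Y : T -> C) : cmeasurable X -> cmeasurable Y ->
  cmeasurable (fun w => X w + Y w).
Proof.
move=> [mX mX'] [mY mY']; split.
  by under eq_fun do rewrite ReD; exact: measurable_funD.
by under eq_fun do rewrite ImD; exact: measurable_funD.
Qed.

Lemma cmeasurableM (X Y : T -> C) : cmeasurable X -> cmeasurable Y ->
  cmeasurable (fun w => X w * Y w).
Proof.
move=> [mX mX'] [mY mY']; split.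
  under eq_fun do rewrite ReM.
  by apply: measurable_funB; exact: measurable_funM.
under eq_fun do rewrite ImM.
by apply: measurable_funD; exact: measurable_funM.
Qed.

Lemma cmeasurable_conj (X : T -> C) : cmeasurable X ->
  cmeasurable (fun w => Num.conj (X w)).
Proof.
move=> [mX mX']; split.
  by rewrite (_ : (fun w => _) = fun w => complex.Re (X w))//; apply/funext => w; case: (X w).
rewrite (_ : (fun w => _) = fun w => - complex.Im (X w)); first exact: measurableT_comp.
by apply/funext => w; case: (X w).
Qed.

Lemma cmeasurable_sum (I : Type) (s : seq I) (X : I -> T -> C) :
  (forall i, cmeasurable (X i)) -> cmeasurable (fun w => \sum_(i <- s) X i w).
Proof.
move=> mX; elim: s => [|i s IH].
  by under eq_fun do rewrite big_nil; exact: cmeasurable_cst.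
by under eq_fun do rewrite big_cons; exact: cmeasurableD.
Qed.

Definition pmeasurable (p : T -> {poly C}) := forall k, cmeasurable (fun w => (p w)`_k).

Lemma pmeasurable_sum (I : Type) (s : seq I) (p : I -> T -> {poly C}) :
  (forall i, pmeasurable (p i)) -> pmeasurable (fun w => \sum_(i <- s) p i w).
Proof.
by move=> mp k; under eq_fun do rewrite coef_sum; apply: cmeasurable_sum => i; exact: mp.
Qed.

Lemma pmeasurableM (p q : T -> {poly C}) : pmeasurable p -> pmeasurable q ->
  pmeasurable (fun w => p w * q w).
Proof.
move=> mp mq k; under eq_fun do rewrite coefM.
by apply: cmeasurable_sum => i; exact: cmeasurableM.
Qed.

Lemma pmeasurable_prod (I : Type) (s : seq I) (p : I -> T -> {poly C}) :
  (forall i, pmeasurable (p i)) -> pmeasurable (fun w => \prod_(i <- s) p i w).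
Proof.
move=> mp; elim: s => [|i s IH].
  by under eq_fun do rewrite big_nil; move=> k; exact: cmeasurable_cst.
by under eq_fun do rewrite big_cons; exact: pmeasurableM.
Qed.

(** The determinant is defined by the Leibniz formula, so each coefficient is a finite sum of
    products of entries and constants. *)
Lemma pmeasurable_char_poly m (A : T -> 'M[C]_m) :
  (forall k j, cmeasurable (fun w => A w k j)) ->
  pmeasurable (fun w => char_poly (A w)).
Proof.
move=> mA; apply: pmeasurable_sum => s; apply: pmeasurableM.
  by move=> k; exact: cmeasurable_cst.
apply: pmeasurable_prod => i k.
under eq_fun do rewrite !mxE coefB coefC.
apply: cmeasurableD; first exact: cmeasurable_cst.
case: (k == 0).
  under eq_fun do rewrite -mulN1r.
  by apply: cmeasurableM; [exact: cmeasurable_cst|exact: mA].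
exact: cmeasurable_cst.
Qed.

Lemma measurable_lambda_max m (A : T -> 'M[C]_m) : (0 < m)%N ->
  (forall w, (A w) ^t* = A w) -> (forall k j, cmeasurable (fun w => A w k j)) ->
  measurable_fun setT (fun w => lambda_max (A w)).
Proof.
move=> m0 Ah mA.
move=> mT; apply: (measurability _ (RGenInftyO.measurableE R)) => //.
move=> _ [_ [c ->] <-].
rewrite setTI.
(* The rays []-oo, c[] generate the Borel sets. There are [m.+1] coefficients, the degree being
   [m]. *)
have -> : (fun w => lambda_max (A w)) @^-1` `]-oo, c[ =
    \bigcap_(k < m.+1) [set w | 0 < complex.Re (char_poly (A w - c%:C%:M))`_k].
  apply/seteqP; split=> w /=; rewrite in_itv/=.
    by move=> /(lambda_max_lt _ m0 (Ah w)) H k /= km; apply: H.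
  by move=> H; apply/(lambda_max_lt _ m0 (Ah w)) => k km; apply: (H k).
apply: bigcap_measurableType => k _.
have : pmeasurable (fun w => char_poly (A w - c%:C%:M)).
  apply: pmeasurable_char_poly => i j; under eq_fun do rewrite !mxE.
  by apply: cmeasurableD; [exact: mA|exact: cmeasurable_cst].
move=> /(_ k)[mp _]; rewrite -[X in measurable X]setTI.
have mlt : measurable_fun setT
    (fun w => 0 < complex.Re (char_poly (A w - c%:C%:M))`_k).
  by apply: measurable_fun_ltr => //; exact: measurable_cst.
exact: (mlt measurableT [set true] I).
Qed.

Lemma cmeasurable_gram p m (A : T -> 'M[C]_(p, m)) :
  (forall k j, cmeasurable (fun w => A w k j)) ->
  forall k j, cmeasurable (fun w => ((A w) ^t* *m A w) k j).
Proof.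
move=> mA k j; under eq_fun do rewrite mxE.
apply: cmeasurable_sum => l; under eq_fun do rewrite !mxE.
by apply: cmeasurableM => //; exact: cmeasurable_conj.
Qed.

Lemma measurable_lambda_min m (A : T -> 'M[C]_m) : (0 < m)%N ->
  (forall w, (A w) ^t* = A w) -> (forall k j, cmeasurable (fun w => A w k j)) ->
  measurable_fun setT (fun w => lambda_min (A w)).
Proof.
move=> m0 Ah mA; under eq_fun do rewrite lambda_minE.
apply: measurableT_comp => //; apply: measurable_lambda_max => // [w|k j].
  exact: hermitianN.
under eq_fun do rewrite mxE -mulN1r.
by apply: cmeasurableM => //; exact: cmeasurable_cst.
Qed.

End measurability.

(** * Products of independent variables *)

Section independence.
Context {d : measure_display} {T : measurableType d} {R : realType}.
Variable P : probability T R.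
Local Open Scope ereal_scope.

(* Monotone class step: an identity known for the indicators of preimages
   under [X] extends to all nonnegative functions of [X]. *)
Lemma ge0_integral_indep_extend d' (T' : measurableType d') (X : T -> T')
    (G : T -> R) (c : \bar R) (f : T' -> R) :
  measurable_fun setT X -> measurable_fun setT G -> (forall w, 0 <= G w)%R ->
  0 <= c -> c \is a fin_num ->
  (forall B, measurable B -> \int[P]_w ((G w)%:E * (\1_B (X w))%:E) = c * P (X @^-1` B)) ->
  measurable_fun setT f -> (forall y, (0 <= f y)%R) ->
  \int[P]_w ((G w)%:E * (f (X w))%:E) = c * \int[P]_w (f (X w))%:E.
Proof.
move=> mX mG G0 c0 cfin H mf f0.
have mGE : measurable_fun setT (fun w => (G w)%:E) by exact/measurable_EFinP.
have mfE : measurable_fun setT (EFin \o f) by exact/measurable_EFinP.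
pose g := nnsfun_approx measurableT mfE.
have mgX n : measurable_fun setT (fun w => (g n (X w))%:E).
  by apply/measurable_EFinP; exact: measurableT_comp.
(* For a simple function both integrals split over its finitely many values, and [H] applies to each
   level set. *)
have simple n : \int[P]_w ((G w)%:E * (g n (X w))%:E) = c * \int[P]_w (g n (X w))%:E.
  pose h := g n.
  have E1 w : (h (X w))%:E = \sum_(y \in range h) (y%:E * (\1_(h @^-1` [set y]) (X w))%:E).
    by rewrite fimfunE -fsumEFin//.
  have h1_ge0 y w : 0 <= y%:E * (\1_(h @^-1` [set y]) (X w))%:E.
    exact: nnfun_muleindic_ge0.
  have mh1 y : measurable_fun setT (fun w => (\1_(h @^-1` [set y]) (X w))%:E : \bar R).
    apply/measurable_EFinP; apply: (measurableT_comp _ mX).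
    exact: measurable_indic.
  have -> : \int[P]_w ((G w)%:E * (g n (X w))%:E) =
      \int[P]_w (\sum_(y \in range h) ((G w)%:E * (y%:E * (\1_(h @^-1` [set y]) (X w))%:E))).
    by apply: eq_integral => w _; rewrite E1 ge0_mule_fsumr.
  have -> : \int[P]_w (g n (X w))%:E =
      \int[P]_w (\sum_(y \in range h) (y%:E * (\1_(h @^-1` [set y]) (X w))%:E)).
    by apply: eq_integral => w _; rewrite E1.
  rewrite !ge0_integral_fsum//; last 3 first.
  - by move=> y; exact: measurable_funeM.
  - by move=> y; apply: emeasurable_funM => //; exact: measurable_funeM.
  - by move=> y w _; apply: mule_ge0; [rewrite lee_fin|exact: h1_ge0].
  rewrite ge0_mule_fsumr; last by move=> y; exact: integral_ge0.
  apply: eq_fsbigr => y /set_mem[x _ hxy].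
  have y0 : (0 <= y)%R by rewrite -hxy.
  have -> : \int[P]_w ((G w)%:E * (y%:E * (\1_(h @^-1` [set y]) (X w))%:E)) =
      \int[P]_w (y%:E * ((G w)%:E * (\1_(h @^-1` [set y]) (X w))%:E)).
    by apply: eq_integral => w _; rewrite muleCA.
  rewrite ge0_integralZl_EFin//; last 2 first.
  - by move=> w _; rewrite mule_ge0 ?lee_fin//.
  - exact: emeasurable_funM.
  rewrite ge0_integralZl_EFin// muleCA; congr (_ * _).
  have -> : \int[P]_w (\1_(h @^-1` [set y]) (X w))%:E = P (X @^-1` (h @^-1` [set y])).
    rewrite -[X in P X]setIT -integral_indic//.
    by rewrite -[X in measurable X]setTI; apply: mX.
  by apply: H.
(* The approximations increase to [f], so monotone convergence passes the identity to the limit on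
   both sides. *)
have nd (w : T) : nondecreasing_seq (fun n => (g n (X w))%:E).
  by move=> a b ab; rewrite lee_fin; exact/lefP/nd_nnsfun_approx.
have gf w : (g n (X w))%:E @[n --> \oo] --> (f (X w))%:E.
  by have := @cvg_nnsfun_approx _ _ _ _ measurableT _ mfE (fun y _ => f0 y) (X w) I.
have E1 : \int[P]_w ((G w)%:E * (f (X w))%:E) =
    limn (fun n => \int[P]_w ((G w)%:E * (g n (X w))%:E)).
  rewrite -monotone_convergence//.
  - apply: eq_integral => w _; apply/esym/cvg_lim => //.
    exact: cvgeZl.
  - by move=> n; exact: emeasurable_funM.
  - by move=> n w _; rewrite mule_ge0 ?lee_fin//.
  - by move=> w _ a b ab; apply: lee_wpmul2l; [rewrite lee_fin|exact: (nd w)].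
have E2 : \int[P]_w (f (X w))%:E = limn (fun n => \int[P]_w (g n (X w))%:E).
  rewrite -monotone_convergence//.
  - by apply: eq_integral => w _; apply/esym/cvg_lim.
  - by move=> n w _; rewrite lee_fin.
rewrite E1 E2 -limeMl//.
  by congr (limn _); apply/funext => n; exact: simple.
apply: ereal_nondecreasing_is_cvgn => a b ab; apply: ge0_le_integral => //.
  by move=> w _; rewrite lee_fin.
by move=> w _; exact: (nd w).
Qed.

(** Indicators are exchanged for the functions [f i] one index at a time. Finiteness of the
    integrals keeps the contribution of the other factors a finite constant. *)
Lemma ge0_integral_indep_prod (I : finType) (X : I -> T -> R) (f : I -> R -> R) :
  (forall i, measurable_fun setT (X i)) ->
  (forall B : I -> set R, (forall i, measurable (B i)) ->
    P (\bigcap_i (X i @^-1` B i)) = \prod_i P (X i @^-1` B i)) ->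
  (forall i, measurable_fun setT (f i)) -> (forall i y, (0 <= f i y)%R) ->
  (forall i, \int[P]_w (f i (X i w))%:E < +oo) ->
  \int[P]_w (\prod_i f i (X i w))%:E = \prod_i \int[P]_w (f i (X i w))%:E.
Proof.
move=> mX indep mf f0 foo.
have mfX i : measurable_fun setT (fun w => f i (X i w)) by exact: measurableT_comp.
have mXB i B : measurable B -> measurable (X i @^-1` B).
  by move=> mB; rewrite -[X in measurable X]setTI; exact: mX.
(* Indices in [s] already carry [f i], the others still the indicator of an arbitrary [B i]. The
   empty [s] is the independence hypothesis, and [s = enum I] is the claim. *)
suff H (s : seq I) : uniq s -> forall B : I -> set R, (forall i, measurable (B i)) ->
    \int[P]_w (\prod_i (if i \in s then f i (X i w) else \1_(B i) (X i w)))%:E =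
    \prod_i (if i \in s then \int[P]_w (f i (X i w))%:E else P (X i @^-1` B i)).
  have := H (enum I) (enum_uniq I) (fun=> setT) (fun=> measurableT).
  under eq_integral do under eq_bigr do rewrite mem_enum /=.
  by under [X in _ = X -> _]eq_bigr do rewrite mem_enum /=.
elim: s => [_ B mB|j s IH /= /andP[js us] B mB].
  rewrite -indep//.
  have mI : measurable (\bigcap_i X i @^-1` B i).
    by apply: fin_bigcap_measurable => // i _; exact: mXB.
  rewrite -[X in P X]setIT -integral_indic//.
  apply: eq_integral => w _; congr EFin.
  rewrite indicE; case: (boolP (w \in _)) => [/set_mem wB|/negP wB].
    by rewrite big1// => i _; rewrite /= indicE mem_set//; exact: wB.
  apply/eqP/prodf_eq0; apply: contrapT => wB0; apply: wB; apply/mem_set => i _ /=.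
  apply: contrapT => wBi; apply: wB0; exists i => //.
  by rewrite /= indicE memNset.
pose G w := (\prod_(i | i != j)
  (if i \in s then f i (X i w) else \1_(B i) (X i w)))%R.
pose c := \prod_(i | i != j)
  (if i \in s then \int[P]_w (f i (X i w))%:E else P (X i @^-1` B i)).
have sE i : i != j -> (i \in j :: s) = (i \in s) by rewrite inE => /negbTE ->.
have mG : measurable_fun setT G.
  rewrite /G; under eq_fun do rewrite big_mkcond/=.
  apply: measurable_prod => i _; case: (i != j); last exact: measurable_cst.
  case: (i \in s); first exact: mfX.
  by apply: measurableT_comp => //; exact: measurable_indic.
have G0 w : (0 <= G w)%R by apply: prodr_ge0 => i _; case: ifP.
have c0 : 0 <= c.
  apply: prode_ge0 => i _; case: ifP => // _.
  by apply: integral_ge0 => w _; rewrite lee_fin.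
have cfin : c \is a fin_num.
  apply: prode_fin_num => i _; case: ifP => _; last exact/fin_num_measure/mXB.
  by rewrite ge0_fin_numE ?foo// integral_ge0// => w _; rewrite lee_fin.
have := @ge0_integral_indep_extend _ _ (X j) G c (f j) (mX j) mG G0 c0 cfin.
move=> /(_ _ (mf j) (f0 j)) E.
rewrite (bigD1 j)//= mem_head muleC.
rewrite (eq_bigr (fun i => if i \in s then \int[P]_w (f i (X i w))%:E
  else P (X i @^-1` B i))); last by move=> i /sE ->.
rewrite -E.
  apply: eq_integral => w _; rewrite -EFinM mulrC (bigD1 j)//= mem_head.
  by congr (_ * _)%:E; apply: eq_bigr => i /sE ->.
(* The identity on sets required by the monotone class step is the induction hypothesis with the set
   at [j] replaced by [B']. *)
move=> B' mB'; pose B2 i := if i == j then B' else B i.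
have mB2 i : measurable (B2 i) by rewrite /B2; case: ifP.
have B2j : B2 j = B' by rewrite /B2 eqxx.
have := IH us B2 mB2; rewrite (bigD1 j)//= (negbTE js) B2j muleC => E2.
have -> : c = \prod_(i | i != j)
    (if i \in s then \int[P]_w (f i (X i w))%:E else P (X i @^-1` B2 i)).
  by apply: eq_bigr => i ij; rewrite /B2 (negbTE ij).
rewrite -E2; apply: eq_integral => w _; rewrite -EFinM (bigD1 j)//= (negbTE js).
rewrite B2j mulrC; congr (_ * _)%:E.
by apply: eq_bigr => i ij; rewrite /B2 (negbTE ij).
Qed.

End independence.

(** * Bernstein's inequality *)

Section bernstein_inequality.
Context {d : measure_display} {T : measurableType d} {R : realType}.
Variable P : probability T R.

(** The series from its quadratic term on, bounded termwise by absolute values. Nonnegative extended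
    real terms allow term-by-term integration later. *)
Lemma expR_sub_taylor1_le (y : R) :
  ((expR y - 1 - y)%:E <=
    \sum_(l <oo) (`|y| ^+ l.+2 / l.+2`!%:R)%:E)%E.
Proof.
have cv : (series (exp_coeff y) k.+2 - 1 - y) @[k --> \oo] --> expR y - 1 - y.
  apply: cvgB; last exact: cvg_cst.
  apply: cvgB; last exact: cvg_cst.
  have /cvg_ex[l sl] := is_cvg_series_exp_coeff y.
  have -> : expR y = l by exact/cvg_lim.
  by move: sl; rewrite -(cvg_shiftn 2); under eq_fun do rewrite addn2.
have -> : (expR y - 1 - y)%:E =
    limn (fun k => (series (exp_coeff y) k.+2 - 1 - y)%:E).
  by apply/esym/cvg_lim => //; apply/cvg_EFin => //; near=> k.
apply: lime_le.
  by apply/cvg_ex; exists (expR y - 1 - y)%:E; apply/cvg_EFin; [near=> k|].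
near=> k; apply: le_trans (nneseries_lim_ge k _); last first.
  by move=> l _ _; rewrite lee_fin divr_ge0.
rewrite sumEFin lee_fin /series/= big_nat_recl// big_nat_recl// /exp_coeff/=.
rewrite expr0 fact0 divr1 expr1 divr1 [1 + _]addrC addrK [y + _]addrC addrK.
apply: ler_sum => l _; rewrite ler_wpM2r ?invr_ge0//.
by rewrite -normrX ler_norm.
Unshelve. all: by end_near.
Qed.

(* [0 ^+ 0 = 1], so for [l = 2] the moment bound is on the variance. *)
Definition bernstein_moments (X : T -> R) (M v : R) := forall l : nat, (2 <= l)%N ->
  ('E_P[fun w => (`|X w| ^+ l)%R] <= (2^-1 * l`!%:R * M ^+ (l - 2) * v)%:E)%E.

Lemma geometric_sum_le (q : R) (n : nat) : 0 <= q < 1 ->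
  \sum_(0 <= l < n) q ^+ l <= (1 - q)^-1.
Proof.
move=> /andP[q0 q1]; rewrite big_mkord -[leRHS]mul1r ler_pdivlMr ?subr_gt0//.
have := subrX1 q n; rewrite -opprB -[X in _ = X * _]opprB mulNr => /oppr_inj.
by rewrite mulrC => <-; rewrite gerBl exprn_ge0.
Qed.

(** Centering removes the linear Taylor term. In the remainder the factorial of the moment bound
    cancels that of the series, which leaves a geometric series of ratio [h * M] with sum at most
    [B]; then [1 + B <= expR B]. *)
Lemma bernstein_mgf_le (X : T -> R) (M v h : R) :
  measurable_fun setT X -> P.-integrable setT (EFin \o X) -> ('E_P[X] = 0)%E ->
  0 <= M -> 0 <= v -> 0 <= h -> h * M < 1 -> bernstein_moments X M v ->
  (\int[P]_w (expR (h * X w))%:E <=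
     (expR (h ^+ 2 * v / (2 * (1 - h * M))))%:E)%E.
Proof.
move=> mX iX EX M0 v0 h0 hM mom.
set B := h ^+ 2 * v / (2 * (1 - h * M)).
have mhX : measurable_fun setT (fun w => h * X w) by exact: measurable_funM.
(* This remainder is nonnegative, so the bound on its integral also yields its integrability, and
   the exponential can be integrated as a sum of three terms. *)
pose r w := expR (h * X w) - 1 - h * X w.
have r0 w : 0 <= r w by rewrite /r -addrA -opprD subr_ge0 expR_ge1Dx.
have mr : measurable_fun setT r.
  apply: measurable_funB => //; apply: measurable_funB => //.
  exact: measurableT_comp.
have mXl l : measurable_fun setT (fun w => (`|h * X w| ^+ l.+2 / l.+2`!%:R)%:E).
  apply/measurable_EFinP; apply: measurable_funM => //.
  by apply: measurable_funX; exact: measurableT_comp.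
have rB : (\int[P]_w (r w)%:E <= B%:E)%E.
  apply: (@le_trans _ _ (\int[P]_w
      \sum_(l <oo) (`|h * X w| ^+ l.+2 / l.+2`!%:R)%:E)%E).
    apply: ge0_le_integral => //.
    - by move=> w _; rewrite lee_fin.
    - exact/measurable_EFinP.
    - by apply: ge0_emeasurable_sum => // l w _ _; rewrite lee_fin divr_ge0.
    - by move=> w _; exact: expR_sub_taylor1_le.
  rewrite integral_nneseries//.
  have term l : (\int[P]_w (`|h * X w| ^+ l.+2 / l.+2`!%:R)%:E <=
      (h ^+ 2 * v / 2 * (h * M) ^+ l)%:E)%E.
    have c0 : 0 <= h ^+ l.+2 / l.+2`!%:R by rewrite divr_ge0// exprn_ge0.
    have -> : (\int[P]_w (`|h * X w| ^+ l.+2 / l.+2`!%:R)%:E =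
        (h ^+ l.+2 / l.+2`!%:R)%:E * 'E_P[fun w => (`|X w| ^+ l.+2)%R])%E.
      rewrite unlock -ge0_integralZl_EFin//.
      - apply: eq_integral => w _; rewrite -EFinM; congr EFin.
        by rewrite normrM (ger0_norm h0) exprMn mulrAC.
      - apply/measurable_EFinP; apply: measurable_funX; exact: measurableT_comp.
    apply: le_trans (lee_wpmul2l _ (mom l.+2 isT)) _; first by rewrite lee_fin.
    rewrite -EFinM lee_fin subSS subSS subn0 exprMn.
    rewrite le_eqVlt; apply/orP; left; apply/eqP.
    have f0 : l.+2`!%:R != 0 :> R by rewrite pnatr_eq0 -lt0n fact_gt0.
    by rewrite !exprS; field.
  apply: le_trans (lee_nneseries _ (fun l _ => term l)) _.
    by move=> l _ _; apply: integral_ge0 => w _; rewrite lee_fin divr_ge0.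
  have t0 l : 0 <= h ^+ 2 * v / 2 * (h * M) ^+ l.
    by rewrite mulr_ge0 ?exprn_ge0 ?divr_ge0 ?mulr_ge0 ?exprn_ge0.
  apply: lime_le; first by apply: is_cvg_nneseries => l _ _; rewrite lee_fin.
  near=> k; rewrite sumEFin lee_fin -mulr_sumr /B invfM mulrA.
  rewrite ler_wpM2l ?divr_ge0 ?mulr_ge0 ?exprn_ge0//.
  by apply: geometric_sum_le; rewrite hM mulr_ge0.
have ir : P.-integrable setT (EFin \o r).
  apply/integrableP; split; first exact/measurable_EFinP.
  apply: le_lt_trans (ltry B); apply: le_trans rB.
  by under eq_integral do rewrite /= ger0_norm//.
have ihX : P.-integrable setT (EFin \o (fun w => h * X w)).
  by rewrite (_ : EFin \o _ = fun w => (h%:E * (X w)%:E)%E)//; exact: integrableZl.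
have i1 : P.-integrable setT (EFin \o cst 1) by exact: finite_measure_integrable_cst.
have i2 : P.-integrable setT (EFin \o (fun w => 1 + h * X w)).
  exact: (integrableD measurableT i1 ihX).
have -> : (\int[P]_w (expR (h * X w)%R)%:E =
    \int[P]_w ((EFin \o r) \+ (EFin \o (fun w => 1 + h * X w)%R)) w)%E.
  by apply: eq_integral => w _ /=; rewrite -EFinD /r; congr EFin; ring.
rewrite (integralD_EFin measurableT ir i2)/=.
have -> : (\int[P]_w (1 + h * X w)%:E =
    \int[P]_w ((EFin \o cst 1%R) \+ (EFin \o (fun w => h * X w)%R)) w)%E by [].
rewrite (integralD_EFin measurableT i1 ihX)/=.
have -> : (\int[P]_w (h * X w)%:E = 0)%E.
  have := EX; rewrite unlock => EX0.
  by under eq_integral do rewrite EFinM; rewrite integralZl// EX0 mule0.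
have := expectation_cst P 1; rewrite unlock => ->; rewrite adde0.
apply: (@le_trans _ _ (B%:E + 1)%E); first exact: leeD2r.
by rewrite -EFinD lee_fin addrC expR_ge1Dx.
Unshelve. all: by end_near.
Qed.

Section sum_of_independent.
Context {I : finType}.
Variables (X : I -> T -> R) (M : R) (v : I -> R).
Hypotheses (mX : forall i, measurable_fun setT (X i))
  (iX : forall i, P.-integrable setT (EFin \o X i))
  (EX : forall i, ('E_P[X i] = 0)%E)
  (indep : forall B : I -> set R, (forall i, measurable (B i)) ->
    P (\bigcap_i (X i @^-1` B i)) = (\prod_i P (X i @^-1` B i))%E)
  (M0 : 0 <= M) (v0 : forall i, 0 <= v i)
  (mom : forall i, bernstein_moments (X i) M (v i)).
Let V := \sum_i v i.

Lemma measurable_sum_ge (x : R) : measurable [set w | x <= \sum_i X i w].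
Proof.
have mS : measurable_fun setT (fun w => \sum_i X i w) by exact: measurable_sum.
have mle : measurable_fun setT (fun w => x <= \sum_i X i w).
  by apply: measurable_fun_ler => //; exact: measurable_cst.
by rewrite -[X in measurable X]setTI; exact: (mle measurableT [set true] Logic.I).
Qed.

(* Chernoff's bound at [h = x / (V + M x)], for which [1 - h M = V / (V + M x)]. *)
Lemma bernstein_upper_tail (x : R) : 0 < x -> 0 < V ->
  (P [set w | (x <= \sum_i X i w)%R] <= (expR (- (x ^+ 2 / (2 * (V + M * x)))))%:E)%E.
Proof.
move=> x0 V0; pose h := x / (V + M * x).
have Mx0 : 0 <= M * x by rewrite mulr_ge0// ltW.
have W0 : 0 < V + M * x by rewrite ltr_wpDr.
have h0 : 0 <= h by rewrite divr_ge0// ltW.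
have hM : h * M < 1 by rewrite /h mulrAC ltr_pdivrMr// mul1r mulrC ltrDr.
pose B i := h ^+ 2 * v i / (2 * (1 - h * M)).
have mgf i := bernstein_mgf_le (mX i) (iX i) (EX i) M0 (v0 i) h0 hM (mom i).
have mf (i : I) : measurable_fun setT (fun y : R => expR (h * y)).
  by apply: measurableT_comp => //; exact: measurable_funM.
have mfX i : measurable_fun setT (fun w => expR (h * X i w)).
  exact: (measurableT_comp (mf i) (mX i)).
have foo i : (\int[P]_w (expR (h * X i w))%:E < +oo)%E.
  by apply: le_lt_trans (mgf i) _; rewrite ltry.
have prodE : (\int[P]_w (\prod_i expR (h * X i w))%:E <= (expR (\sum_i B i))%:E)%E.
  rewrite (ge0_integral_indep_prod mX indep mf _ foo); last first.
    by move=> i y; rewrite expR_ge0.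
  rewrite expR_sum -prodEFin.
  have : (0 <= \prod_i \int[P]_w (expR (h * X i w))%:E <=
      \prod_i (expR (B i))%:E)%E.
    apply: (@big_ind2 _ _ (fun a b => 0 <= a <= b)%E); first by rewrite lee_fin ler01 lexx.
      move=> a b a' b' /andP[a0 ab] /andP[a'0 ab'].
      by rewrite mule_ge0//= lee_pmul.
    move=> i _; rewrite mgf andbT; apply: integral_ge0 => w _.
    exact: expR_ge0.
  by case/andP.
have mE : measurable_fun setT (fun w => \prod_i expR (h * X i w)).
  by apply: measurable_prod => i _.
have mA := measurable_sum_ge x.
rewrite -[X in P X]setIT -integral_indic//.
(* Markov's inequality: with [S] the sum of the [X i w], the indicator of [x <= S] is at most
   [expR (h * (S - x))], which factors over [i]. *)
apply: (@le_trans _ _ (\int[P]_w ((expR (- (h * x)))%:E *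
    (\prod_i expR (h * X i w))%:E))%E).
  apply: ge0_le_integral => //.
  - exact/measurable_EFinP/measurable_indic.
  - by apply/measurable_EFinP; exact: measurable_funM.
  move=> w _; rewrite -EFinM lee_fin -expR_sum -expRD -mulr_sumr.
  rewrite indicE; case: (boolP (w \in _)) => [/set_mem/= xw|_]; last exact: expR_ge0.
  by rewrite -expR0 ler_expR addrC subr_ge0 ler_wpM2l.
rewrite ge0_integralZl_EFin ?expR_ge0//; last 2 first.
- by move=> w _; rewrite lee_fin prodr_ge0// => i _; exact: expR_ge0.
- exact/measurable_EFinP.
apply: le_trans (lee_wpmul2l _ prodE) _; first by rewrite lee_fin expR_ge0.
(* For this [h] the exponent [- h x + h^2 V / (2 (1 - h M))] equals [- x^2 / (2 (V + M x))]; the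
   computation divides by [V]. *)
rewrite -EFinM lee_fin -expRD ler_expR /B -mulr_suml -mulr_sumr -/V.
rewrite le_eqVlt; apply/orP; left; apply/eqP; rewrite /h.
have W1 : V + M * x != 0 by rewrite gt_eqF.
have V1 : V != 0 by rewrite gt_eqF.
have -> : 1 - x / (V + M * x) * M = V / (V + M * x) by field.
by field; apply/andP.
Qed.

End sum_of_independent.

(** The bound at [l = 2] makes the second moment 0. This serves the case of total variance 0, out of
    reach of the Chernoff bound. *)
Lemma moment2_eq0 (X : T -> R) (M : R) : measurable_fun setT X ->
  bernstein_moments X M 0 -> {ae P, forall w, X w = 0}.
Proof.
move=> mX /(_ 2%N isT); rewrite mulr0 unlock => X20.
have mX2 : measurable_fun setT (fun w => (`|X w| ^+ 2)%:E).
  by apply/measurable_EFinP; apply: measurable_funX; exact: measurableT_comp.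
have : (\int[P]_w `|(`|X w| ^+ 2)%:E| = 0)%E.
  apply/eqP; rewrite eq_le integral_ge0// andbT; apply: le_trans X20.
  rewrite le_eqVlt; apply/orP; left; apply/eqP; apply: eq_integral => w _.
  by rewrite gee0_abs// lee_fin exprn_ge0.
move=> /(ae_eq_integral_abs _ measurableT mX2); apply: filterS => w /(_ Logic.I).
by case=> /eqP; rewrite sqrf_eq0 normr_eq0 => /eqP.
Qed.

(** The upper tail is applied to the [X i] and to their opposites. The [if] mirrors the convention
    for a zero denominator, which can occur only when the total variance is 0. *)
Lemma bernstein_two_sided {I : finType} (X : I -> T -> R) (M : R) (v : I -> R) (x : R) :
  (forall i, measurable_fun setT (X i)) ->
  (forall i, P.-integrable setT (EFin \o X i)) ->
  (forall i, ('E_P[X i] = 0)%E) ->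
  (forall B : I -> set R, (forall i, measurable (B i)) ->
    P (\bigcap_i (X i @^-1` B i)) = (\prod_i P (X i @^-1` B i))%E) ->
  0 <= M -> (forall i, 0 <= v i) ->
  (forall i, bernstein_moments (X i) M (v i)) -> 0 < x ->
  (P [set w | (x <= `|\sum_i X i w|)%R] <=
    (2 * (if \sum_i v i + M * x == 0 then 0
          else expR (- (x ^+ 2 / (2 * (\sum_i v i + M * x)))))%R)%:E)%E.
Proof.
move=> mX iX EX indep M0 v0 mom x0; set V := \sum_i v i.
have setE : [set w | x <= `|\sum_i X i w|] =
    [set w | x <= \sum_i X i w] `|` [set w | x <= \sum_i - X i w].
  apply/seteqP; split=> w /=; rewrite sumrN ler_normr; first by move/orP.
  by case=> ->; rewrite ?orbT.
have mNX i : measurable_fun setT (fun w => - X i w) by exact: measurableT_comp.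
have mA := measurable_sum_ge mX x; have mB := measurable_sum_ge mNX x.
have V0 : 0 <= V by rewrite sumr_ge0.
(* If [V = 0], every [v i] is 0, almost surely all summands vanish, and the event is negligible; the
   bound is nonnegative in either branch of the [if]. *)
have [VE|Vn0] := eqVneq V 0.
  have X0 : {ae P, forall w, forall i, X i w = 0}.
    apply: filter_forall => i; apply: (@moment2_eq0 (X i) M) => //.
    by have := mom i; rewrite (psumr_eq0P (fun i _ => v0 i) VE).
  rewrite (measure_negligible _ (A := [set w | x <= `|\sum_i X i w|])).
  - by rewrite lee_fin mulr_ge0//; case: ifP => // _; exact: expR_ge0.
  - by rewrite setE; exact: measurableU.
  - apply: negligibleS X0 => w /= xw X0; move: xw.
    by rewrite big1 ?normr0 ?leNgt ?x0.
have Vgt0 : 0 < V by rewrite lt_def Vn0.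
have W0 : 0 < V + M * x by rewrite ltr_wpDr// mulr_ge0// ltW.
rewrite gt_eqF// setE; apply: le_trans (measureU2 _ mA mB) _.
rewrite mulr_natl mulr2n EFinD; apply: leeD; first exact: bernstein_upper_tail.
apply: (@bernstein_upper_tail _ (fun i w => - X i w)) => //.
- move=> i; rewrite (_ : EFin \o _ = -%E \o (EFin \o X i))//; exact: integrableN.
- move=> i; have := EX i; rewrite unlock => EXi.
  have -> : (\int[P]_w (- X i w)%:E = \int[P]_w ((-1)%:E * (X i w)%:E))%E.
    by apply: eq_integral => w _; rewrite -EFinM mulN1r.
  by rewrite -[RHS](mule0 (-1)%:E) -EXi; exact: (integralZl measurableT (iX i)).
- move=> B mB'; pose B' i := -%R @^-1` B i.
  have -> : \bigcap_i (fun w => - X i w) @^-1` B i = \bigcap_i X i @^-1` B' i by [].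
  apply: indep => i; rewrite -[X in measurable X]setTI.
  exact: (oppr_measurable measurableT (mB' i)).
- move=> i l l2; apply: le_trans (mom i l l2).
  by rewrite unlock; under eq_integral do rewrite normrN.
Qed.

End bernstein_inequality.

(** * Concentration of the sample moment matrix *)

Section complex_expectation.
Context {d : measure_display} {T : measurableType d} {R : realType}.
Variable P : probability T R.
Local Notation C := R[i].

Lemma fine_expectation_sum (I : finType) (f : I -> T -> R) (c : R) :
  (forall i, P.-integrable setT (EFin \o f i)) ->
  fine 'E_P[fun w => c * \sum_i f i w] = c * \sum_i fine 'E_P[f i].
Proof.
move=> fi; rewrite unlock.
have ffin i : (\int[P]_w (f i w)%:E)%E \is a fin_num.
  exact: integrable_fin_num (fi i).
have sE : (\int[P]_w (\sum_i f i w)%:E = \sum_i \int[P]_w (f i w)%:E)%E.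
  rewrite -(integral_sum measurableT fi).
  by apply: eq_integral => w _; rewrite sumEFin.
have si : P.-integrable setT (EFin \o (fun w => \sum_i f i w)).
  rewrite (_ : EFin \o _ = fun w => (\sum_i (EFin \o f i) w)%E).
    by apply: integrable_sum.
  by apply/funext => w; rewrite /= sumEFin.
have -> : (\int[P]_w (c * \sum_i f i w)%:E = c%:E * \int[P]_w (\sum_i f i w)%:E)%E.
  by rewrite -(integralZl measurableT si).
rewrite sE fineM//; last by apply/sum_fin_numP.
by rewrite sum_fine.
Qed.

Lemma fine_expectationN (f : T -> R) : P.-integrable setT (EFin \o f) ->
  fine 'E_P[fun w => - f w] = - fine 'E_P[f].
Proof.
move=> fi; have := @fine_expectation_sum 'I_1 (fun=> f) (-1) (fun=> fi).
rewrite big_ord1 mulN1r => <-; congr (fine 'E_P[_]).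
by apply/funext => w; rewrite big_ord1 mulN1r.
Qed.

Lemma expectation_centered (f : T -> R) : P.-integrable setT (EFin \o f) ->
  ('E_P[fun w => (f w - fine 'E_P[f])%R] = 0)%E.
Proof.
move=> fi; rewrite unlock.
have ffin : (\int[P]_w (f w)%:E)%E \is a fin_num by exact: integrable_fin_num fi.
set c := fine _.
have ci : P.-integrable setT (EFin \o cst c) by exact: finite_measure_integrable_cst.
have := expectation_cst P c; rewrite unlock => Ec.
have -> : (\int[P]_w (f w - c)%:E = \int[P]_w ((f w)%:E - (cst c w)%:E))%E by [].
by rewrite (integralB_EFin measurableT fi ci) Ec /c fineK// subee.
Qed.

Definition cintegrable (X : T -> C) :=
  P.-integrable setT (EFin \o (fun w => complex.Re (X w))) /\
  P.-integrable setT (EFin \o (fun w => complex.Im (X w))).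

Lemma real_complexMl (c : R) (z : C) : c%:C * z = (c * complex.Re z) +i* (c * complex.Im z).
Proof. by case: z => a b; simpc. Qed.

Lemma cexpectation_sum (I : finType) (X : I -> T -> C) (c : R) :
  (forall i, cintegrable (X i)) ->
  cexpectation P (fun w => c%:C * \sum_i X i w) =
  c%:C * \sum_i cexpectation P (X i).
Proof.
move=> Xi; rewrite real_complexMl Re_sum Im_sum /=; congr (_ +i* _).
  rewrite -(fine_expectation_sum c (fun i => (Xi i).1)); congr (fine 'E_P[_]).
  by apply/funext => w; rewrite real_complexMl Re_sum.
rewrite -(fine_expectation_sum c (fun i => (Xi i).2)); congr (fine 'E_P[_]).
by apply/funext => w; rewrite real_complexMl Im_sum.
Qed.

Lemma cexpectation_conj (X : T -> C) : cintegrable X ->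
  cexpectation P (fun w => Num.conj (X w)) = Num.conj (cexpectation P X).
Proof.
move=> [Xr Xi]; rewrite -[RHS]/(_ -i* _); congr (_ +i* _).
  by congr (fine 'E_P[_]); apply/funext => w; case: (X w).
rewrite -fine_expectationN//; congr (fine 'E_P[_]).
by apply/funext => w; case: (X w).
Qed.

(** Both parts of the product are dominated by the integrable sum of the squared moduli of [X] and
    [Y]. *)
Lemma cintegrable_conjM (X Y : T -> C) : cmeasurable X -> cmeasurable Y ->
  ('E_P[fun w => (ComplexField.Normc.normc (X w) ^+ 2)%R] < +oo)%E ->
  ('E_P[fun w => (ComplexField.Normc.normc (Y w) ^+ 2)%R] < +oo)%E ->
  cintegrable (fun w => Num.conj (X w) * Y w).
Proof.
move=> mX mY X2 Y2.
have sqE (z : C) : ComplexField.Normc.normc z ^+ 2 =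
    complex.Re z ^+ 2 + complex.Im z ^+ 2.
  by case: z => a b /=; rewrite sqr_sqrtr// addr_ge0 ?sqr_ge0.
have i2 (Z : T -> C) : cmeasurable Z ->
    ('E_P[fun w => (ComplexField.Normc.normc (Z w) ^+ 2)%R] < +oo)%E ->
    P.-integrable setT (EFin \o (fun w => complex.Re (Z w) ^+ 2 + complex.Im (Z w) ^+ 2)).
  move=> [mr mi] Z2; apply/integrableP; split.
    apply/measurable_EFinP; apply: measurable_funD; exact: measurable_funX.
  move: Z2; rewrite unlock; apply: le_lt_trans.
  rewrite le_eqVlt; apply/orP; left; apply/eqP; apply: eq_integral => w _ /=.
  by rewrite sqE ger0_norm// addr_ge0 ?sqr_ge0.
have [mr mi] := cmeasurableM (cmeasurable_conj mX) mY.
have iS := integrableD measurableT (i2 X mX X2) (i2 Y mY Y2).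
have sqs a b a' b' : `|a * a' + b * b'| <= (a ^+ 2 + b ^+ 2) + (a' ^+ 2 + b' ^+ 2) :> R.
  have := (sqr_ge0 a, sqr_ge0 b, sqr_ge0 a', sqr_ge0 b').
  have := (sqr_ge0 (a + a'), sqr_ge0 (b + b'), sqr_ge0 (a - a'), sqr_ge0 (b - b')).
  by move=> [[[? ?] ?] ?] [[[? ?] ?] ?]; rewrite ler_norml; apply/andP; split; nra.
split; apply: le_integrable iS => //; try exact/measurable_EFinP.
  move=> w _; rewrite /= lee_fin [leRHS]ger0_norm ?addr_ge0 ?sqr_ge0//.
  case: (X w) (Y w) => a b [a' b'] /=; apply: le_trans (sqs a b a' b').
  by rewrite mulNr opprK.
move=> w _; rewrite /= lee_fin [leRHS]ger0_norm ?addr_ge0 ?sqr_ge0//.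
case: (X w) (Y w) => a b [a' b'] /=.
(* The imaginary part [a b' - b a'] is the expression bounded for the real part, taken at
   [(b', - a')]. *)
by have := sqs a b b' (- a'); rewrite sqrrN mulrN -mulNr [b' ^+ 2 + _]addrC.
Qed.

End complex_expectation.

Section row_independence.
Context {d : measure_display} {T : measurableType d} {R : realType}.
Context {n D : nat} (U : T -> 'M[R[i]]_(n, D)).

(* The measurability lemmas are reused on [T] equipped with the sigma-algebra of
   row [t] instead of the ambient one. *)
Lemma cmeasurable_row_sigma (t : 'I_n) (k : 'I_D) :
  @cmeasurable _ (g_sigma_algebraType (row_sigma U t)) R (fun w => U w t k).
Proof.
have mp : measurable_fun [set: g_sigma_algebraType (row_sigma U t)]
    (fun w => (complex.Re (U w t k), complex.Im (U w t k))).
  (* Two inclusions: into the sigma-algebra generated by [row_sigma U t], and into [row_sigma U t],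
     which is itself generated. *)
  move=> _ Y mY; rewrite setTI; do 2 apply: sub_sigma_algebra => /=.
  rewrite -bigcup_seq/=; exists k => /=; first by rewrite mem_index_enum.
  by exists Y => //; rewrite setTI.
by split; [exact: (measurableT_comp measurable_fst mp)
          |exact: (measurableT_comp measurable_snd mp)].
Qed.

(** [row_sigma U t] is a sigma-algebra already, so generating from it again adds no set. *)
Lemma row_sigma_preimage (t : 'I_n) (f : T -> R) (B : set R) :
  measurable_fun [set: g_sigma_algebraType (row_sigma U t)] f ->
  measurable B -> row_sigma U t (f @^-1` B).
Proof.
move=> mf mB; have := mf measurableT B mB; rewrite setTI.
apply: smallest_sub => //; exact: smallest_sigma_algebra.
Qed.

End row_independence.

Lemma sum_ord_const (R' : nzRingType) (m : nat) (c : R') :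
  \sum_(i < m) c = m%:R * c.
Proof. by rewrite sumr_const card_ord mulr_natl. Qed.

Section sample_moment_concentration.
Context {R : realType} {d : measure_display} {T : measurableType d}.
Variables (P : probability T R) (n D : nat).
Hypotheses (n_gt0 : (0 < n)%N) (D_gt0 : (0 < D)%N).
Variable U : T -> 'M[R[i]]_(n, D).
Hypotheses (U_meas : forall t k, cmeasurable (fun w => U w t k))
  (U_indep : independent_rows P U)
  (U_L2 : forall t k,
    ('E_P[fun w => (ComplexField.Normc.normc (U w t k) ^+ 2)%R] < +oo)%E).
Local Notation C := R[i].

Definition gram_entry t k j w : C := Num.conj (U w t k) * U w t j.

(** Indexed like the constants [v] and [M], so that the good event ranges over the same triples
    [(i, k, j)] as the sum in [Psi]. *)
Definition part (i : 'I_2) (z : C) : R :=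
  if i == 0 then complex.Re z else complex.Im z.

Definition deviation i t k j w : R :=
  part i (gram_entry t k j w - row_moment P U t k j).

Lemma partD i (x y : C) : part i (x + y) = part i x + part i y.
Proof. by rewrite /part; case: ifP; rewrite (ReD, ImD). Qed.

Lemma partN i (x : C) : part i (- x) = - part i x.
Proof. by rewrite /part; case: ifP; case: x. Qed.

Lemma part_sum i (I : Type) (s : seq I) (F : I -> C) :
  part i (\sum_(k <- s) F k) = \sum_(k <- s) part i (F k).
Proof. by rewrite /part; case: ifP; rewrite (Re_sum, Im_sum). Qed.

Lemma part_realM i (c : R) (z : C) : part i (c%:C * z) = c * part i z.
Proof. by rewrite real_complexMl /part; case: ifP. Qed.

Lemma ord2P (Q : 'I_2 -> Prop) : Q 0 -> Q 1 -> forall i, Q i.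
Proof.
move=> Q0 Q1 [[|[|//]] hi].
  by rewrite (_ : Ordinal hi = 0)//; exact: val_inj.
by rewrite (_ : Ordinal hi = 1)//; exact: val_inj.
Qed.

Lemma natC_inv : (n%:R : C)^-1 = (n%:R^-1 : R)%:C.
Proof. by rewrite fmorphV rmorph_nat. Qed.

Lemma cintegrable_entry t k j : cintegrable P (gram_entry t k j).
Proof. exact: cintegrable_conjM. Qed.

Lemma row_momentE t k j : row_moment P U t k j = cexpectation P (gram_entry t k j).
Proof.
rewrite mxE; congr cexpectation; apply/funext => w.
by rewrite !mxE big_ord1 !mxE.
Qed.

Lemma sample_momentE w k j :
  sample_moment U w k j = (n%:R^-1)%:C * \sum_t gram_entry t k j w.
Proof.
rewrite mxE natC_inv mxE; congr (_ * _); apply: eq_bigr => t _.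
by rewrite !mxE.
Qed.

Lemma mean_momentE k j :
  mean_moment P U k j = (n%:R^-1)%:C * \sum_t cexpectation P (gram_entry t k j).
Proof.
rewrite mxE natC_inv summxE; congr (_ * _); apply: eq_bigr => t _.
exact: row_momentE.
Qed.

Lemma mean_moment_expectation :
  mean_moment P U = mx_expectation P (sample_moment U).
Proof.
apply/matrixP => k j; rewrite mean_momentE mxE.
rewrite -(cexpectation_sum _ (fun t => cintegrable_entry t k j)).
by congr cexpectation; apply/funext => w; rewrite sample_momentE.
Qed.

Lemma sample_moment_hermitian w : (sample_moment U w) ^t* = sample_moment U w.
Proof.
by rewrite /sample_moment natC_inv; apply: hermitianZ; exact: hermitian_gram.
Qed.

Lemma mean_moment_hermitian : (mean_moment P U) ^t* = mean_moment P U.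
Proof.
rewrite /mean_moment natC_inv; apply: hermitianZ.
apply/matrixP => k j; rewrite !mxE !summxE rmorph_sum; apply: eq_bigr => t _.
rewrite !row_momentE.
transitivity (cexpectation P (fun w => Num.conj (gram_entry t j k w))).
  exact/esym/cexpectation_conj/cintegrable_entry.
congr cexpectation; apply/funext => w.
by rewrite /gram_entry rmorphM/= conjCK mulrC.
Qed.

Lemma sample_deviationE i w k j :
  part i ((sample_moment U w - mean_moment P U) k j) =
  n%:R^-1 * \sum_t deviation i t k j w.
Proof.
have -> : (sample_moment U w - mean_moment P U) k j =
    (n%:R^-1)%:C * \sum_t (gram_entry t k j w - row_moment P U t k j).
  rewrite !mxE -/(sample_moment U w k j).
  transitivity (sample_moment U w k j - mean_moment P U k j).
    by rewrite ![in RHS]mxE.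
  rewrite sample_momentE mean_momentE -mulrBr -sumrB.
  by congr (_ * _); apply: eq_bigr => t _; rewrite row_momentE.
by rewrite part_realM part_sum.
Qed.

Lemma measurable_deviation i t k j : measurable_fun setT (deviation i t k j).
Proof.
have [mr mi] : cmeasurable (fun w => gram_entry t k j w - row_moment P U t k j).
  apply: cmeasurableD; last exact: cmeasurable_cst.
  by apply: cmeasurableM => //; exact: cmeasurable_conj.
by rewrite /deviation /part; case: (i == 0).
Qed.

(** Taking a part commutes with [cexpectation]; a deviation is thus a real variable minus its own
    mean. *)
Lemma deviationE i t k j : deviation i t k j =
  fun w => part i (gram_entry t k j w)
           - fine 'E_P[fun w => part i (gram_entry t k j w)].
Proof.
apply/funext => w; rewrite /deviation partD partN row_momentE; congr (_ - _).
by rewrite /part; case: (i == 0).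
Qed.

Lemma part_entry_integrable i t k j :
  P.-integrable setT (EFin \o (fun w => part i (gram_entry t k j w))).
Proof.
by have [er ei] := cintegrable_entry t k j; rewrite /part; case: (i == 0).
Qed.

Lemma deviation_integrable i t k j :
  P.-integrable setT (EFin \o deviation i t k j).
Proof.
rewrite deviationE; set c := fine _.
have ci : P.-integrable setT (EFin \o cst c) by exact: finite_measure_integrable_cst.
exact: (integrableB measurableT (part_entry_integrable i t k j) ci).
Qed.

Lemma expectation_deviation i t k j : ('E_P[deviation i t k j] = 0)%E.
Proof.
by rewrite deviationE; apply: expectation_centered; exact: part_entry_integrable.
Qed.

(** With [(i, k, j)] fixed, the deviation of row [t] is a function of that row alone, so its
    preimages lie in [row_sigma U t]. *)
Lemma deviation_indep i k j (B : 'I_n -> set R) : (forall t, measurable (B t)) ->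
  P (\bigcap_t (deviation i t k j @^-1` B t)) =
  (\prod_t P (deviation i t k j @^-1` B t))%E.
Proof.
move=> mB; have := @U_indep [set: 'I_n]%SET (fun t => deviation i t k j @^-1` B t).
have -> : [set` [set: 'I_n]%SET] = setT by apply/seteqP; split=> // t _; rewrite /= inE.
move=> ->; first by apply: eq_bigl => t; rewrite inE.
move=> t _; apply: row_sigma_preimage => //.
have [mr mi] : @cmeasurable _ (g_sigma_algebraType (row_sigma U t)) R
    (fun w => gram_entry t k j w - row_moment P U t k j).
  apply: cmeasurableD; last exact: cmeasurable_cst.
  apply: cmeasurableM; last exact: cmeasurable_row_sigma.
  by apply: cmeasurable_conj; exact: cmeasurable_row_sigma.
by rewrite /deviation /part; case: (i == 0).
Qed.

Variables M v : 'I_2 -> 'I_n -> 'I_D -> 'I_D -> R.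
Hypotheses (M_ge0 : forall i t k j, 0 <= M i t k j)
  (v_ge0 : forall i t k j, 0 <= v i t k j)
  (moments : forall i t k j,
    bernstein_moments P (deviation i t k j) (M i t k j) (v i t k j)).

(** Chernoff's parameter is shared by all rows, so one [M] has to serve them all, whereas the [v]
    are summed. *)
Lemma deviation_moments i t k j :
  bernstein_moments P (deviation i t k j) (M_max M i k j) (v i t k j).
Proof.
move=> l l2; apply: le_trans (moments i t k j l2) _.
rewrite lee_fin ler_wpM2r// ler_wpM2l ?mulr_ge0 ?invr_ge0//.
apply: lerXn2r; rewrite ?nnegrE//; first exact: bigmax_ge_id.
exact: (le_bigmax _ (fun t => M i t k j)).
Qed.

Lemma deviation_tail i k j (eps : R) : 0 < eps ->
  (P [set w | (n%:R * eps / (Num.sqrt 2 * D%:R) <=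
               `|\sum_t deviation i t k j w|)%R] <=
    (2 * bernstein_exp n D (v_sum v i k j) (M_max M i k j) eps)%:E)%E.
Proof.
move=> eps0; set x := n%:R * eps / (Num.sqrt 2 * D%:R).
have n0 : 0 < n%:R :> R by rewrite ltr0n.
have D0 : 0 < D%:R :> R by rewrite ltr0n.
have s0 : 0 < Num.sqrt 2 :> R by rewrite sqrtr_gt0.
have s2 : Num.sqrt 2 ^+ 2 = 2 :> R by rewrite sqr_sqrtr.
have x0 : 0 < x by rewrite divr_gt0 ?mulr_gt0.
have := bernstein_two_sided (fun t => measurable_deviation i t k j)
  (fun t => deviation_integrable i t k j) (fun t => expectation_deviation i t k j)
  (@deviation_indep i k j) (bigmax_ge_id _ _ _ _)
  (fun t => v_ge0 i t k j) (fun t => deviation_moments i t k j) x0.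
move/le_trans; apply; rewrite lee_fin ler_wpM2l//.
rewrite -/(v_sum v i k j) -/(M_max M i k j) /bernstein_exp.
set V := v_sum v i k j; set W := M_max M i k j.
(* Since [x^2 = n^2 eps^2 / (2 D^2)], this turns [x^2 / (2 (V + W x))] into the exponent in [Psi].
   The factor [4 D^2 / n] is nonzero, so both denominators vanish together and the conventions
   agree. *)
have denE : D%:R ^+ 2 * (4 * n%:R^-1 * V + 2 * Num.sqrt 2 * D%:R^-1 * W * eps) =
    4 * D%:R ^+ 2 / n%:R * (V + W * x).
  have -> : 2 * Num.sqrt 2 = 4 / Num.sqrt 2 :> R.
    apply: (mulIf (lt0r_neq0 s0)); rewrite divfK ?gt_eqF// -mulrA -expr2 s2.
    by ring.
  by rewrite /x; field; rewrite !gt_eqF.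
have c0 : 4 * D%:R ^+ 2 / n%:R != 0 :> R.
  by rewrite gt_eqF// divr_gt0// mulr_gt0// exprn_gt0.
rewrite denE mulf_eq0 (negbTE c0) /=; case: eqVneq => // W0.
rewrite le_eqVlt; apply/orP; left; apply/eqP; congr (expR (- _)).
rewrite {1}/x expr_div_n exprMn [(_ * D%:R) ^+ 2]exprMn s2.
by field; rewrite W0 !gt_eqF.
Qed.

(** The single good event behind all three probability statements, each of whose events contains
    it. *)
Definition small_deviations (eps : R) : set T :=
  [set w | forall i k j, `|\sum_t deviation i t k j w|
                           < n%:R * eps / (Num.sqrt 2 * D%:R)].

(** Union bound over the triples [(i, k, j)]; the factor 2 in [Psi] accounts for the two tails. *)
Lemma small_deviations_prob (eps : R) : 0 < eps ->
  with_prob_ge P (1 - Psi v M eps) (small_deviations eps).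
Proof.
move=> eps0; set x := n%:R * eps / (Num.sqrt 2 * D%:R).
pose A (p : 'I_2 * ('I_D * 'I_D)) :=
  [set w | x <= `|\sum_t deviation p.1 t p.2.1 p.2.2 w|].
have mA p : measurable (A p).
  have mS : measurable_fun setT (fun w => `|\sum_t deviation p.1 t p.2.1 p.2.2 w|).
    apply: measurableT_comp => //; apply: measurable_sum => t.
    exact: measurable_deviation.
  have mle : measurable_fun setT
      (fun w => x <= `|\sum_t deviation p.1 t p.2.1 p.2.2 w|).
    by apply: measurable_fun_ler => //; exact: measurable_cst.
  by rewrite -[X in measurable X]setTI; exact: (mle measurableT [set true] Logic.I).
have smallE : small_deviations eps = ~` \big[setU/set0]_p A p.
  rewrite -bigcup_seq; apply/seteqP; split=> [w ws [[i [k j]] _ /=]|w ws i k j].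
    by rewrite /A/= leNgt ws.
  rewrite ltNge; apply/negP => wA; apply: ws; exists (i, (k, j)) => //=.
  exact: mem_index_enum.
have mB : measurable (\big[setU/set0]_p A p) by exact: bigsetU_measurable.
rewrite smallE; split; first exact: measurableC.
rewrite probability_setC// EFinB; apply: leeB => //.
have boole (s : seq ('I_2 * ('I_D * 'I_D))) :
    (P (\big[setU/set0]_(p <- s) A p) <= \sum_(p <- s) P (A p))%E.
  elim: s => [|p s IH]; first by rewrite !big_nil measure0.
  rewrite !big_cons; apply: le_trans (measureU2 _ _ _) _ => //.
    exact: bigsetU_measurable.
  exact: leeD.
apply: le_trans (boole _) _.
have -> : (Psi v M eps)%:E = (\sum_p (2 * bernstein_exp n D (v_sum v p.1 p.2.1 p.2.2)
    (M_max M p.1 p.2.1 p.2.2) eps)%:E)%E.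
  rewrite sumEFin -mulr_sumr /Psi; congr (2 * _)%:E.
  by under eq_bigr do rewrite pair_bigA /=; rewrite pair_bigA.
by apply: lee_sum => p _; exact: deviation_tail.
Qed.

Lemma small_deviations_opnorm (eps : R) w : 0 < eps -> small_deviations eps w ->
  opnorm (sample_moment U w - mean_moment P U) < eps.
Proof.
move=> eps0 ws; set S := sample_moment U w - mean_moment P U.
have n0 : 0 < n%:R :> R by rewrite ltr0n.
have D0 : 0 < D%:R :> R by rewrite ltr0n.
have s0 : 0 < Num.sqrt 2 :> R by rewrite sqrtr_gt0.
have s2 : Num.sqrt 2 ^+ 2 = 2 :> R by rewrite sqr_sqrtr.
have part_lt i k j : part i (S k j) ^+ 2 < eps ^+ 2 / (2 * D%:R ^+ 2).
  have -> : eps ^+ 2 / (2 * D%:R ^+ 2) = (eps / (Num.sqrt 2 * D%:R)) ^+ 2.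
    by rewrite expr_div_n exprMn s2.
  rewrite -[ltLHS]real_normK ?num_real// ltrXn2r//.
  rewrite sample_deviationE normrM ger0_norm ?invr_ge0//.
  rewrite mulrC ltr_pdivrMr//; apply: lt_le_trans (ws i k j) _.
  by rewrite [eps / _ * _]mulrAC [n%:R * eps]mulrC.
rewrite /opnorm -[ltRHS]ger0_norm ?(ltW eps0)// -sqrtr_sqr ltr_sqrt ?exprn_gt0//.
apply: le_lt_trans (lambda_max_gram_le _ D_gt0) _.
have -> : eps ^+ 2 = \sum_(j < D) \sum_(k < D) (eps ^+ 2 / D%:R ^+ 2).
  by rewrite !sum_ord_const; field; rewrite gt_eqF.
(* Summing strict inequalities stays strict only over a nonempty index set. *)
have hasD : has xpredT (index_enum 'I_D).
  by apply/hasP; exists (Ordinal D_gt0) => //; exact: mem_index_enum.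
apply: ltr_sum => // j _; apply: ltr_sum => // k _.
have -> : eps ^+ 2 / D%:R ^+ 2 =
    eps ^+ 2 / (2 * D%:R ^+ 2) + eps ^+ 2 / (2 * D%:R ^+ 2).
  by field; rewrite gt_eqF.
exact: (ltrD (part_lt 0 k j) (part_lt 1 k j)).
Qed.

Lemma cmeasurable_sample_moment k j : cmeasurable (fun w => sample_moment U w k j).
Proof.
under eq_fun do rewrite sample_momentE.
apply: cmeasurableM; first exact: cmeasurable_cst.
apply: cmeasurable_sum => t.
by apply: cmeasurableM => //; exact: cmeasurable_conj.
Qed.

Lemma measurable_opnorm_lt (eps : R) : 0 < eps ->
  measurable [set w | opnorm (sample_moment U w - mean_moment P U) < eps].
Proof.
move=> eps0; pose S w := sample_moment U w - mean_moment P U.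
have mS k j : cmeasurable (fun w => S w k j).
  under eq_fun do rewrite /S mxE.
  by apply: cmeasurableD; [exact: cmeasurable_sample_moment|exact: cmeasurable_cst].
have mG : measurable_fun setT (fun w => lambda_max ((S w) ^t* *m S w)).
  apply: measurable_lambda_max => // [w|]; first exact: hermitian_gram.
  exact: cmeasurable_gram.
have mlt : measurable_fun setT (fun w => lambda_max ((S w) ^t* *m S w) < eps ^+ 2).
  by apply: measurable_fun_ltr => //; exact: measurable_cst.
have -> : [set w | opnorm (S w) < eps] =
    setT `&` [set w | lambda_max ((S w) ^t* *m S w) < eps ^+ 2].
  rewrite setTI; apply/funext => w /=; congr is_true.
  by rewrite /opnorm -[ltRHS]ger0_norm ?(ltW eps0)// -sqrtr_sqr ltr_sqrt ?exprn_gt0.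
exact: (mlt measurableT [set true] Logic.I).
Qed.

Lemma measurable_sample_lambda_max :
  measurable_fun setT (fun w => lambda_max (sample_moment U w)).
Proof.
apply: measurable_lambda_max => //; first exact: sample_moment_hermitian.
exact: cmeasurable_sample_moment.
Qed.

Lemma measurable_sample_lambda_min :
  measurable_fun setT (fun w => lambda_min (sample_moment U w)).
Proof.
apply: measurable_lambda_min => //; first exact: sample_moment_hermitian.
exact: cmeasurable_sample_moment.
Qed.

End sample_moment_concentration.

(** The denominator grows with the constants. The convention respects this: a zero denominator gives
    the value 0, below every exponential, and a positive one stays positive. *)
Lemma bernstein_exp_le (R : realType) (n D : nat) (v v' M M' eps : R) :
  (0 < n)%N -> (0 < D)%N -> 0 < eps ->
  0 <= v -> v <= v' -> 0 <= M -> M <= M' ->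
  bernstein_exp n D v M eps <= bernstein_exp n D v' M' eps.
Proof.
move=> n_gt0 D_gt0 eps0 v0 vv' M0 MM'; rewrite /bernstein_exp.
have n0 : 0 < n%:R :> R by rewrite ltr0n.
have D0 : 0 < D%:R :> R by rewrite ltr0n.
set den := _ * (_ + _ * M * eps); set den' := _ * (_ + _ * M' * eps).
have den0 : 0 <= den.
  by rewrite !(mulr_ge0, addr_ge0, invr_ge0, exprn_ge0, sqrtr_ge0)// ltW.
have den_le : den <= den'.
  apply: ler_wpM2l; first exact: exprn_ge0.
  apply: lerD; first by rewrite ler_wpM2l// divr_ge0.
  apply: ler_wpM2r; first exact: ltW.
  by rewrite ler_wpM2l// !(mulr_ge0, invr_ge0, sqrtr_ge0).
have [_|den_n0] := eqVneq den 0.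
  by case: ifP => // _; exact: expR_ge0.
have den_gt0 : 0 < den by rewrite lt_def den_n0.
have den'_gt0 := lt_le_trans den_gt0 den_le.
rewrite gt_eqF// ler_expR lerN2; apply: ler_wpM2l; last by rewrite lef_pV2.
by rewrite mulr_ge0// exprn_ge0// ltW.
Qed.

Lemma Psi_le (R : realType) (n D : nat)
    (v M : 'I_2 -> 'I_n -> 'I_D -> 'I_D -> R) (eps : R) :
  (0 < n)%N -> (0 < D)%N -> 0 < eps -> (forall i t k j, 0 <= v i t k j) ->
  Psi v M eps <= 4 * D%:R ^+ 2 * bernstein_exp n D (v_bound v) (M_bound M) eps.
Proof.
move=> n_gt0 D_gt0 eps0 v0; set b := bernstein_exp _ _ _ _ _.
have bound (F : 'I_2 -> 'I_D -> 'I_D -> R) i k j : F i k j <=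
    \big[Num.max/0]_(i < 2) \big[Num.max/0]_(k < D) \big[Num.max/0]_(j < D) F i k j.
  apply: le_trans (le_bigmax _ (fun i => _) i).
  apply: le_trans (le_bigmax _ (fun k => _) k).
  exact: (le_bigmax _ (F i k)).
have -> : 4 * D%:R ^+ 2 * b = 2 * \sum_(i < 2) \sum_(k < D) \sum_(j < D) b.
  by rewrite !sum_ord_const; ring.
rewrite ler_wpM2l//; do 3 apply: ler_sum => ? _.
apply: bernstein_exp_le => //; first by rewrite sumr_ge0.
exact: bigmax_ge_id.
Qed.

(** Put in the division-free form of [gram_cond_number_le]; [eps < l] makes both [l - eps] and [a]
    positive. *)
Lemma le_ratio_enlarge (R : realFieldType) (eps l L a b : R) :
  eps < l -> l - eps < a -> a <= b -> b < L + eps ->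
  0 < a /\ b <= (L + eps) / (l - eps) * a.
Proof.
move=> el la ab bL; have l0 : 0 < l - eps by rewrite subr_gt0.
have a0 : 0 < a := lt_trans l0 la.
split=> //; apply: le_trans (ltW bL) _; rewrite mulrAC ler_pdivlMr//.
by rewrite ler_wpM2l// ltW// (lt_trans _ bL)// (lt_le_trans a0).
Qed.

Theorem theorem3p6 (R : realType) (d : measure_display) (T : measurableType d)
    (P : probability T R) (n D : nat) (n_gt0 : (0 < n)%N) (D_gt0 : (0 < D)%N)
    (U : T -> 'M[R[i]]_(n, D))
    (U_meas : forall t k, cmeasurable (fun w => U w t k))
    (U_indep : independent_rows P U)
    (U_L2 : forall t k, ('E_P[fun w => (ComplexField.Normc.normc (U w t k) ^+ 2)%R] < +oo)%E)
    (M v : 'I_2 -> 'I_n -> 'I_D -> 'I_D -> R)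
    (M_ge0 : forall i t k j, 0 <= M i t k j)
    (v_ge0 : forall i t k j, 0 <= v i t k j)
    (Re_moments : forall (l : nat) t k j, (2 <= l)%N ->
      ('E_P[fun w =>
          (`|complex.Re ((U w t k)^* * U w t j - row_moment P U t k j)| ^+ l)%R]
       <= (2^-1 * l`!%:R * M 0 t k j ^+ (l - 2) * v 0 t k j)%R%:E)%E)
    (Im_moments : forall (l : nat) t k j, (2 <= l)%N ->
      ('E_P[fun w =>
          (`|complex.Im ((U w t k)^* * U w t j - row_moment P U t k j)| ^+ l)%R]
       <= (2^-1 * l`!%:R * M 1 t k j ^+ (l - 2) * v 1 t k j)%R%:E)%E) :
  mean_moment P U = mx_expectation P (sample_moment U) /\
  forall eps : R, 0 < eps ->
  [/\ with_prob_ge P (1 - Psi v M eps)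
        [set w | opnorm (sample_moment U w - mean_moment P U) < eps],
      1 - Psi v M eps >=
        1 - 4 * D%:R ^+ 2 * bernstein_exp n D (v_bound v) (M_bound M) eps,
      with_prob_ge P (1 - Psi v M eps)
        [set w | lambda_min (mean_moment P U) - eps
                   < lambda_min (sample_moment U w) /\
                 lambda_min (sample_moment U w)
                   <= lambda_max (sample_moment U w) /\
                 lambda_max (sample_moment U w)
                   < lambda_max (mean_moment P U) + eps]
    & mean_moment P U \in unitmx -> eps < lambda_min (mean_moment P U) ->
      with_prob_ge P (1 - Psi v M eps)
        [set w | (U w) ^t* *m U w \in unitmx /\
                 cond_number ((U w) ^t* *m U w)
                   <= (lambda_max (mean_moment P U) + eps)
                        / (lambda_min (mean_moment P U) - eps)] ].
Proof.
split; first exact: mean_moment_expectation.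
move=> eps eps0; set Q := mean_moment P U; set p := 1 - Psi v M eps.
have moments i t k j :
    bernstein_moments P (deviation P U i t k j) (M i t k j) (v i t k j).
  by elim/ord2P: i => l l2; [exact: Re_moments|exact: Im_moments].
pose G := small_deviations P U eps.
have [mG pG] : with_prob_ge P p G by exact: small_deviations_prob.
(* Each probability claim is thereby split into the measurability of its event and the inclusion of
   [G]. *)
have enlarge E : measurable E -> G `<=` E -> with_prob_ge P p E.
  by move=> mE GE; split => //; apply: le_trans pG _; apply: le_measure; rewrite ?inE.
have Gop w : G w -> opnorm (sample_moment U w - Q) < eps.
  exact: small_deviations_opnorm.
have Sh w := sample_moment_hermitian U w.
have Qh : Q ^t* = Q by exact: mean_moment_hermitian.
have Glambda w : G w -> lambda_min Q - eps < lambda_min (sample_moment U w) /\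
    lambda_max (sample_moment U w) < lambda_max Q + eps.
  by move=> /Gop; exact: lambda_perturbation.
have mmax := measurable_sample_lambda_max D_gt0 U_meas.
have mmin := measurable_sample_lambda_min D_gt0 U_meas.
have m3 : measurable [set w | lambda_min Q - eps < lambda_min (sample_moment U w) /\
    lambda_min (sample_moment U w) <= lambda_max (sample_moment U w) /\
    lambda_max (sample_moment U w) < lambda_max Q + eps].
  have m31 : measurable_fun setT (fun w =>
      lambda_min Q - eps < lambda_min (sample_moment U w)).
    by apply: measurable_fun_ltr => //; exact: measurable_cst.
  have m32 : measurable_fun setT (fun w =>
      lambda_min (sample_moment U w) <= lambda_max (sample_moment U w)).
    exact: measurable_fun_ler.
  have m33 : measurable_fun setT (fun w =>
      lambda_max (sample_moment U w) < lambda_max Q + eps).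
    by apply: measurable_fun_ltr => //; exact: measurable_cst.
  have := measurableI _ _ (m31 measurableT [set true] Logic.I)
    (measurableI _ _ (m32 measurableT [set true] Logic.I)
      (m33 measurableT [set true] Logic.I)).
  by rewrite !setTI.
split.
- by apply: enlarge => //; exact: measurable_opnorm_lt.
- by rewrite lerD2l lerN2; exact: Psi_le.
- apply: enlarge => // w /Glambda[minw maxw]; split => //; split => //.
  exact: lambda_min_le_max.
move=> _ epsQ; set c := _ / _.
have n0 : 0 < (n%:R : R)^-1 by rewrite invr_gt0 ltr0n.
have UUh w : ((U w) ^t* *m U w) ^t* = (U w) ^t* *m U w by exact: hermitian_gram.
have sampleE w : sample_moment U w = (n%:R^-1)%:C *: ((U w) ^t* *m U w).
  by rewrite /sample_moment natC_inv.
have minE w : lambda_min (sample_moment U w) =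
    n%:R^-1 * lambda_min ((U w) ^t* *m U w).
  by rewrite sampleE; exact: lambda_minZ.
have maxE w : lambda_max (sample_moment U w) =
    n%:R^-1 * lambda_max ((U w) ^t* *m U w).
  by rewrite sampleE; exact: lambda_maxZ.
(* Rewritten through the eigenvalues of the sample moment, the event is a pair of inequalities
   between measurable functions. *)
have -> : [set w | (U w) ^t* *m U w \in unitmx /\
      cond_number ((U w) ^t* *m U w) <= c] =
    [set w | 0 < lambda_min (sample_moment U w) /\
      lambda_max (sample_moment U w) <= c * lambda_min (sample_moment U w)].
  by apply/funext => w; apply/propext; rewrite /= minE maxE; exact: gram_cond_number_le.
apply: enlarge => [|w /Glambda[minw maxw] /=].
  have m41 : measurable_fun setT (fun w => 0 < lambda_min (sample_moment U w)).
    by apply: measurable_fun_ltr => //; exact: measurable_cst.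
  have m42 : measurable_fun setT (fun w =>
      lambda_max (sample_moment U w) <= c * lambda_min (sample_moment U w)).
    by apply: measurable_fun_ler => //; exact: measurable_funM.
  have := measurableI _ _ (m41 measurableT [set true] Logic.I)
    (m42 measurableT [set true] Logic.I).
  by rewrite !setTI.
exact: (le_ratio_enlarge epsQ minw (lambda_min_le_max D_gt0 (Sh w)) maxw).
Qed.
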